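(* Let $(X_i,\mathcal A_i,\nu_i)$, $i=1,2$, be standard $\sigma$-finite measure spaces. (1) Let $P:X_1\times\mathcal A_2\to[0,1]$ and $Q:X_2\times\mathcal A_1\to[0,1]$ form a dual pair of probability kernels associated to the measures $\nu_1$ and $\nu_2$. Then $P$ defines a contractive operator $T_P:L^2(\nu_2)\to L^2(\nu_1)$. Similarly, $T_Q$ is a contractive operator from $L^2(\nu_1)$ to $L^2(\nu_2)$. (2) Suppose that $(P,Q)$ is a pair of dual probability transition kernels associated to $\nu_1$ and $\nu_2$ as in (1). Then $$\langle f,T_P(g)\rangle_{L^2(\nu_1)}=\langle T_Q(f),g\rangle_{L^2(\nu_2)},\qquad f\in L^2(\nu_1),\ g\in L^2(\nu_2),$$ i.e. $(T_P)^*=T_Q$ and $(T_Q)^*=T_P$. (3) Let $P:X_1\times\mathcal A_2\to[0,\infty)$ and $Q:X_2\times\mathcal A_1\to[0,\infty)$ be finite transition kernels satisfying $d\nu_1(x)P(x,dy)=d\nu_2(y)Q(y,dx)$, and suppose that $P(\chi_B)\in L^2(\nu_1)$ and $Q(\chi_A)\in L^2(\nu_2)$ for any Borel sets $A\in\mathcal A_1$ and $B\in\mathcal A_2$ of finite measure. Then the operators $$T_P:L^2(\nu_2)\to L^2(\nu_1):\ f\mapsto\int_{X_2}P(x,dy)f(y),\qquad T_Q:L^2(\nu_1)\to L^2(\nu_2):\ f\mapsto\int_{X_1}Q(y,dx)f(x)$$ are densely defined, and they satisfy $T_P\subset(T_Q)^*$, $T_Q\subset(T_P)^*$. The operators $T_P$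 and $T_Q$ are closable.
   Context: A map $R:X\times\mathcal A'\to[0,\infty)$ (with $(X,\mathcal A)$, $(X',\mathcal A')$ standard Borel) is a transition kernel if $x\mapsto R(x,C)$ is Borel for every $C\in\mathcal A'$ and $C\mapsto R(x,C)$ is a $\sigma$-finite Borel measure for every $x\in X$; it is finite if $0<R(x,X')<\infty$ for every $x$, and a probability kernel if $R(x,X')=1$ for every $x$. Kernels $P:X_1\times\mathcal A_2\to[0,\infty)$ and $Q:X_2\times\mathcal A_1\to[0,\infty)$ form a dual pair associated to $\nu_1,\nu_2$ if $d\nu_1(x)P(x,dy)=d\nu_2(y)Q(y,dx)$, i.e. both sides define the same measure on $X_1\times X_2$: $\int\!\!\int d\nu_1(x)P(x,dy)f(x,y)=\int\!\!\int d\nu_2(y)Q(y,dx)f(x,y)$ for bounded Borel $f$. The operators are $T_P(g)(x)=\int_{X_2}P(x,dy)g(y)$, $T_Q(f)(y)=\int_{X_1}Q(y,dx)f(x)$, and $P(\chi_B)(x)=P(x,B)$, $Q(\chi_A)(y)=Q(y,A)$. In (3) the operators are considered on the dense domains $\mathcal F(\nu_2)$ and $\mathcal F(\nu_1)$, respectively, where $\mathcal F(\nu_i)$ is the linear span of characteristic functions of sets of finite $\nu_i$-measure. $S\subset T$ for unbounded operators means containment of graphs. *)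

(* Defs.v *)
From HB Require Import structures.
From mathcomp Require Import all_boot all_order all_algebra.
From mathcomp Require Import generic_quotient ring_quotient complex.
From mathcomp Require Import all_classical all_reals all_analysis.
Import Order.TTheory GRing.Theory Num.Theory.
Import numFieldNormedType.Exports.

Set Implicit Arguments.
Unset Strict Implicit.
Unset Printing Implicit Defensive.

Local Open Scope classical_set_scope.
Local Open Scope ring_scope.

(* A standard Borel space is a set with the Borel sigma-algebra of a Polish
   topology; the topology is carried by U and transported along the
   bijection e. *)
Definition standard_borel (R : realType) d (T : measurableType d) : Prop :=
  exists (U : completePseudoMetricType R) (e : T -> U),
    [/\ bijective e, hausdorff_space U,
        exists2 D : set U, countable D & dense D
      & forall A : set T, measurable A <-> <<s [set O : set U | open O] >> (e @` A)].

(* L^2 spaces are taken over the reals or over the complex numbers; this type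
   selects the field. *)
Variant scalar_kind := RealScalars | ComplexScalars.

Definition scalars (R : realType) (k : scalar_kind) : numFieldType :=
  match k with RealScalars => R | ComplexScalars => complex.complex R end.

Section scalars_coordinates.
Context {R : realType} {k : scalar_kind}.

Definition re : scalars R k -> R :=
  match k with RealScalars => id | ComplexScalars => @complex.Re R end.

Definition im : scalars R k -> R :=
  match k with RealScalars => fun=> 0 | ComplexScalars => @complex.Im R end.

(* a + i b, where b is dropped over the reals *)
Definition mk_scalar : R -> R -> scalars R k :=
  match k with RealScalars => fun a _ => a
             | ComplexScalars => @complex.Complex R end.

Definition conj : scalars R k -> scalars R k :=
  match k with RealScalars => id | ComplexScalars => @complex.conjc R end.

Lemma reD : {morph re : x y / x + y}.
Proof. by rewrite /re; case: k => // -[a b] [c e]. Qed.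

Lemma imD : {morph im : x y / x + y}.
Proof. by rewrite /im; case: k => [x y|[a b] [c e]//]; rewrite addr0. Qed.

Lemma reM x y : re (x * y) = re x * re y - im x * im y.
Proof.
by move: x y; rewrite /re /im; case: k => [x y|[a b] [c e]//]; rewrite mulr0 subr0.
Qed.

Lemma imM x y : im (x * y) = re x * im y + im x * re y.
Proof.
move: x y; rewrite /re /im; case: k => [x y|[a b] [c e]//].
by rewrite mulr0 mul0r addr0.
Qed.

Lemma re0 : re 0 = 0. Proof. by rewrite /re; case: k. Qed.

Lemma im0 : im 0 = 0. Proof. by rewrite /im; case: k. Qed.

End scalars_coordinates.

Section L2_functions.
Context {R : realType} (k : scalar_kind) {d} {T : measurableType d}.
Variable mu : {measure set T -> \bar R}.
Local Notation K := (scalars R k).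

Definition square_integrable : {pred T -> K^o} :=
  [pred f | (re \o f \in Lfun mu 2%:E) && (im \o f \in Lfun mu 2%:E)].

Lemma square_integrable_submod_closed : submod_closed square_integrable.
Proof.
have S := @Lfun_submod_closed d T R mu 2%:E (lee1n 2).
have S0 : (0 : T -> R) \in Lfun mu 2%:E by case: S.
have SZ a (f : T -> R) : f \in Lfun mu 2%:E -> a *: f \in Lfun mu 2%:E.
  by move=> f2; rewrite -[_ *: _]addr0; case: S => _; apply.
have SD (f g : T -> R) : f \in Lfun mu 2%:E -> g \in Lfun mu 2%:E ->
    f + g \in Lfun mu 2%:E.
  by move=> f2 g2; rewrite -[f]scale1r; case: S => _; apply.
split.
  rewrite inE; apply/andP; split.
    by rewrite (_ : _ \o _ = 0)//; apply/funext => x; exact: re0.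
  by rewrite (_ : _ \o _ = 0)//; apply/funext => x; exact: im0.
move=> a f g /andP[rf mf] /andP[rg mg]; rewrite inE; apply/andP; split.
  rewrite (_ : _ \o _ = re a *: (re \o f) + (- im a *: (im \o f) + (re \o g))).
    by apply: (SD); [exact: SZ | apply: SD => //; exact: SZ].
  apply/funext => x; rewrite [LHS]reD [X in X + _ = _]reM -addrA.
  by rewrite -mulNr.
rewrite (_ : _ \o _ = re a *: (im \o f) + (im a *: (re \o f) + (im \o g))).
  by apply: (SD); [exact: SZ | apply: SD => //; exact: SZ].
by apply/funext => x; rewrite [LHS]imD [X in X + _ = _]imM -addrA.
Qed.

HB.instance Definition _ := GRing.isSubmodClosed.Build _ _ square_integrable
  square_integrable_submod_closed.

Record L2fun := L2Fun {
  L2fun_val :> T -> K^o;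
  L2fun_valP : L2fun_val \in square_integrable }.

HB.instance Definition _ := [isSub for L2fun_val].
HB.instance Definition _ := [Choice of L2fun by <:].
HB.instance Definition _ := [SubChoice_isSubLmodule of L2fun by <:].

Definition L2null : {pred L2fun} :=
  [pred f : L2fun | `[< \forall x \ae mu, f x = 0 >]].

Lemma L2null_zmod_closed : zmod_closed L2null.
Proof.
split; first by apply/asboolP; apply: (@aeW _ _ _ mu) => x.
move=> f g /asboolP f0 /asboolP g0; apply/asboolP.
by apply: filterS2 f0 g0 => x /= fx gx; rewrite [LHS]/(f x - g x) fx gx; exact: subr0.
Qed.

HB.instance Definition _ := GRing.isZmodClosed.Build _ L2null L2null_zmod_closed.

End L2_functions.

Arguments L2null {R} k {d T} mu _.

Section L2_space.
Context {R : realType} (k : scalar_kind) {d} {T : measurableType d}.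
Variable mu : {measure set T -> \bar R}.
Local Notation K := (scalars R k).
Local Open Scope quotient_scope.

Definition integral_scalar (f : T -> K) : K :=
  mk_scalar (\int[mu]_x re (f x)) (\int[mu]_x im (f x)).

Definition integrable_scalar (f : T -> K) : Prop :=
  mu.-integrable setT (EFin \o (re \o f)) /\
  mu.-integrable setT (EFin \o (im \o f)).

(* L^2(mu): square-integrable functions modulo equality almost everywhere.
   The library's LspaceType is real and carries no vector space structure. *)
Definition L2 : Type := Quotient.quot (L2null k mu).

HB.instance Definition _ := GRing.Zmodule.on L2.
HB.instance Definition _ : EqQuotient _ _ L2 := EqQuotient.on L2.

Definition L2_scale (a : K) (f : L2) : L2 := \pi_L2 (a *: (repr f : L2fun k mu)).

Lemma pi_L2_scale (a : K) (f : L2fun k mu) : \pi_L2 (a *: f) = L2_scale a (\pi_L2 f).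
Proof.
apply/eqP; rewrite -[_ == _]/(_ == _ %[mod L2]) -Quotient.idealrBE -scalerBr.
have : f - repr (\pi_L2 f) \in L2null k mu by rewrite Quotient.idealrBE reprK.
move=> /asboolP h; apply/asboolP; apply: filterS h => x /= fx.
exact: etrans (congr1 ( *%R a) fx) (mulr0 a).
Qed.

Lemma L2_scaleA a b f : L2_scale a (L2_scale b f) = L2_scale (a * b) f.
Proof. by elim/quotW: f => f; rewrite -(pi_L2_scale b f) -!pi_L2_scale scalerA. Qed.

Lemma L2_scale1 f : L2_scale 1 f = f.
Proof. by rewrite /L2_scale scale1r reprK. Qed.

Lemma L2_scaleDr : right_distributive L2_scale +%R.
Proof.
move=> a; elim/quotW=> f; elim/quotW=> g.
rewrite -(pi_L2_scale a f) -(pi_L2_scale a g) -raddfD -(pi_L2_scale a (f + g)).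
by rewrite scalerDr raddfD.
Qed.

Lemma L2_scaleDl f : {morph L2_scale^~ f : a b / a + b}.
Proof.
by elim/quotW: f => f a b; rewrite -(pi_L2_scale (a + b)) -(pi_L2_scale a) -(pi_L2_scale b) scalerDl raddfD.
Qed.

HB.instance Definition _ := GRing.Zmodule_isLmodule.Build K L2
  L2_scaleA L2_scale1 L2_scaleDr L2_scaleDl.

Definition L2_class (f : L2fun k mu) : L2 := \pi_L2 f.

Definition L2_repr (f : L2) : T -> K := repr f.

Definition inner (f g : L2) : K :=
  integral_scalar (fun x => L2_repr f x * conj (L2_repr g x)).

Definition L2norm (f : L2) : R := Num.sqrt (re (inner f f)).

(* The linear span of characteristic functions of sets of finite measure *)
Definition finite_measure_span : set L2 :=
  [set f | exists (n : nat) (c : 'I_n -> K) (A : 'I_n -> set T),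
    (forall i, measurable (A i) /\ (mu (A i) < +oo)%E) /\
    \forall x \ae mu, L2_repr f x = \sum_(i < n) c i * \1_(A i) x].

End L2_space.

Arguments finite_measure_span {R} k {d T} mu _.

Section unbounded_operators.
Context {R : realType} {k : scalar_kind} {d1 d2 : measure_display}.
Context {X1 : measurableType d1} {X2 : measurableType d2}.
Context {nu1 : {measure set X1 -> \bar R}} {nu2 : {measure set X2 -> \bar R}}.

(* A possibly unbounded operator from L^2(nu1) to L^2(nu2) is given by its
   graph; inclusion of operators is inclusion of graphs. *)
Implicit Types G : set (L2 k nu1 * L2 k nu2).

Definition is_operator G : Prop :=
  [/\ G 0, forall a p q, G p -> G q -> G (a *: p + q)
    & forall f h h', G (f, h) -> G (f, h') -> h = h'].

Definition operator_graph (T : L2 k nu1 -> L2 k nu2) : set (L2 k nu1 * L2 k nu2) :=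
  [set p | p.2 = T p.1].

Definition domain G : set (L2 k nu1) := [set f | exists h, G (f, h)].

Definition L2_dense (D : set (L2 k nu1)) : Prop :=
  forall f (e : R), 0 < e -> exists2 g, D g & L2norm (f - g) < e.

Definition densely_defined G : Prop := L2_dense (domain G).

(* The pairs (h, h') such that <T f, h> = <f, h'> for all f in the domain of T *)
Definition adjoint G : set (L2 k nu2 * L2 k nu1) :=
  [set p | forall q, G q -> inner q.2 p.1 = inner q.1 p.2].

Definition graph_closure G : set (L2 k nu1 * L2 k nu2) :=
  [set p | forall e : R, 0 < e -> exists q,
    [/\ G q, L2norm (p.1 - q.1) < e & L2norm (p.2 - q.2) < e]].

Definition closable G : Prop := is_operator (graph_closure G).

End unbounded_operators.

Section kernels.
Context {R : realType} {d1 d2 : measure_display}.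
Context {X1 : measurableType d1} {X2 : measurableType d2}.
Variables (nu1 : {measure set X1 -> \bar R}) (nu2 : {measure set X2 -> \bar R}).
Implicit Types (P : X1 -> {measure set X2 -> \bar R}).
Implicit Types (Q : X2 -> {measure set X1 -> \bar R}).

Definition positive_finite_kernel P : Prop :=
  forall x, (0 < P x setT < +oo)%E.

(* nu1(dx) P(x, dy) and nu2(dy) Q(y, dx) are the same measure on X1 * X2 *)
Definition dual_pair P Q : Prop :=
  forall E : set (X1 * X2), measurable E ->
    (\int[nu1]_x P x (xsection E x) = \int[nu2]_y Q y (ysection E y))%E.

(* The graph of g |-> (x |-> \int P(x, dy) g(y)), restricted to g in D. The
   universal quantification over the representatives of p.1 makes membership
   of p.1 in the domain include independence of the representative. *)
Definition kernel_operator k P (D : set (L2 k nu2)) :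
    set (L2 k nu2 * L2 k nu1) :=
  [set p | D p.1 /\
    forall g : L2fun k nu2, L2_class g = p.1 ->
      \forall x \ae nu1, integrable_scalar (P x) g /\
        L2_repr p.2 x = integral_scalar (P x) g].

End kernels.

Arguments positive_finite_kernel {R d1 d2 X1 X2} P.
Arguments kernel_operator {R d1 d2 X1 X2} nu1 nu2 {k} P D.

(* Main.v *)
Require Import Defs.
From HB Require Import structures.
From mathcomp Require Import all_boot all_order all_algebra finmap.
From mathcomp Require Import generic_quotient ring_quotient.
From mathcomp Require Import all_classical all_reals all_analysis.
From mathcomp Require Import measurable_realfun lra.
Import Order.TTheory GRing.Theory Num.Theory.
Import numFieldNormedType.Exports.

Set Implicit Arguments.
Unset Strict Implicit.
Unset Printing Implicit Defensive.

Local Open Scope classical_set_scope.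
Local Open Scope ring_scope.

(** Testing the dual pair on rectangles and passing to monotone limits gives
    [\int f(x) (\int P(x,dy) g(y)) dnu1 = \int g(y) (\int Q(y,dx) f(x)) dnu2] for
    nonnegative [f], [g]; taking [f = 1] shows that nu2-null sets are P(x,.)-null
    for nu1-almost every x, so that the operators act on classes.  For signed [u]
    everything happens on the functions with [P|u|] in L^2(nu1), where [u] is
    split into its positive and negative parts: duality is then bilinear
    bookkeeping.  For probability kernels this domain is all of L^2(nu2), by
    Jensen's inequality [(P u)^2 <= P (u^2)], which also gives contractivity;
    in (3) it contains the span of the indicators of sets of finite measure.
    Closability holds because the dual operator is densely defined, so that its
    adjoint is a closed operator extending the given one. *)

(** * Scalars *)

(** The scalar field may be R or C, so the analysis is carried out on real functions, and scalar
    statements are read off through [re] and [im], with which integration against a kernel commutes.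
    Imaginary parts of inner products are never estimated directly: multiplication by i turns them
    into real parts. Two obstacles shape the rest. The real-valued integral is [fine] of an extended
    one, hence silently 0 where that one is infinite, so u |-> \int P(x,dy) u(y) is additive only at
    those x where the integrands are integrable; integrability for almost every x is therefore
    carried as part of the domain. And the common measure on the product space is never built:
    identities between iterated integrals are proved in one argument at a time, both sides being
    functionals of that argument that are determined by their values on indicators. *)

Section scalars_theory.
Context {R : realType} {k : scalar_kind}.
Local Notation K := (scalars R k).
Implicit Types x y : K.

Lemma scalar_ext x y : re x = re y -> im x = im y -> x = y.
Proof. by move: x y; rewrite /re /im; case: k => // -[a b] [c e] /= -> ->. Qed.

Lemma re_mk (a b : R) : re (mk_scalar a b : K) = a.
Proof. by rewrite /re /mk_scalar; case: k. Qed.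

Lemma im_mk0 (a : R) : im (mk_scalar a 0 : K) = 0.
Proof. by rewrite /im /mk_scalar; case: k. Qed.

Lemma re_conj x : re (conj x) = re x.
Proof. by move: x; rewrite /re /conj; case: k => // -[]. Qed.

Lemma im_conj x : im (conj x) = - im x.
Proof. by move: x; rewrite /im /conj; case: k => [|[]]//; rewrite oppr0. Qed.

Lemma reN : {morph @re R k : x / - x}.
Proof. by move=> x; apply/eqP; rewrite -subr_eq0 opprK -reD addNr re0. Qed.

Lemma imN : {morph @im R k : x / - x}.
Proof. by move=> x; apply/eqP; rewrite -subr_eq0 opprK -imD addNr im0. Qed.

(** [mk_scalar 0 1] is i over the complex numbers and 0 over the reals, so one identity serves both
    fields. It converts bounds on real parts of inner products into bounds on imaginary parts. *)
Lemma im_re x : im x = - re (mk_scalar 0 1 * x).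
Proof.
rewrite reM re_mk mul0r sub0r opprK.
by move: x; rewrite /im /mk_scalar; case: k => [?|[a b]]; rewrite ?mul0r ?mul1r.
Qed.

Lemma scalarE x : x = mk_scalar (re x) 0 + mk_scalar 0 1 * mk_scalar (im x) 0.
Proof.
apply: scalar_ext; rewrite ?(reD, imD, reM, imM) !(re_mk, im_mk0);
  rewrite ?mulr0 ?subr0 ?mul0r ?addr0 ?add0r//.
by move: x; rewrite /im /mk_scalar; case: k => [?|[a b]]; rewrite ?mul0r ?mul1r.
Qed.

Lemma conj_mk (a b : R) : conj (mk_scalar a b : K) = mk_scalar a (- b).
Proof. by rewrite /conj /mk_scalar; case: k. Qed.

Lemma conjD : {morph @conj R k : x y / x + y}.
Proof.
by move=> x y; apply: scalar_ext; rewrite ?(re_conj, im_conj, reD, imD)// opprD.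
Qed.

Lemma conjM : {morph @conj R k : x y / x * y}.
Proof.
move=> x y; apply: scalar_ext; rewrite ?(re_conj, im_conj, reM, imM)//.
  by rewrite mulrNN.
by rewrite mulrN mulNr opprD.
Qed.

Lemma conjK : involutive (@conj R k).
Proof. by move=> x; apply: scalar_ext; rewrite ?(re_conj, im_conj)// opprK. Qed.

Lemma conj0 : conj 0 = 0 :> K.
Proof. by apply: scalar_ext; rewrite ?(re_conj, im_conj, re0, im0)// oppr0. Qed.

Lemma mk_scalarD (a b : R) : mk_scalar (a + b) 0 = mk_scalar a 0 + mk_scalar b 0 :> K.
Proof. by apply: scalar_ext; rewrite ?(reD, imD, re_mk, im_mk0) ?addr0. Qed.

Lemma mk_scalar0 : mk_scalar 0 0 = 0 :> K.
Proof. by apply: scalar_ext; rewrite ?(re_mk, im_mk0) ?(re0, im0). Qed.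

(** Inner products are shown to vanish by approximating an argument within [e], which leaves a bound
    linear in [e] with a fixed constant. *)
Lemma scalar_small_eq0 (z : K) (C : R) :
  (forall e : R, 0 < e -> `|re z| <= C * e /\ `|im z| <= C * e) -> z = 0.
Proof.
have small (x : R) : (forall e : R, 0 < e -> `|x| <= C * e) -> x = 0.
  move=> xC; apply/eqP; rewrite -normr_le0; apply/ler_addgt0Pl => e e0.
  (* The tolerance is divided by [|C| + 1] because [C] itself may be 0 or negative. *)
  have C0 : 0 < `|C| + 1 by rewrite ltr_pwDr.
  rewrite addr0 (le_trans (xC (e / (`|C| + 1)) _)) ?divr_gt0//.
  rewrite mulrCA ger_pMr// ler_pdivrMr// mul1r.
  by rewrite (le_trans (ler_norm _))// lerDl.
by move=> zC; apply: scalar_ext; rewrite ?re0 ?im0; apply: small => e /zC[].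
Qed.

(** The modulus with values in [R], to be combined with [L2norm]; the norm of the scalar field takes
    its values in the field itself. *)
Definition scalar_norm (a : K) : R := Num.sqrt (re a ^+ 2 + im a ^+ 2).

End scalars_theory.

(** * Real integrals and square integrability up to null sets *)

Section ae_Rintegral.
Context {R : realType} {d} {T : measurableType d}.
Variable mu : {measure set T -> \bar R}.

Lemma ae_eq_Rintegral (f g : T -> R) :
  measurable_fun setT f -> measurable_fun setT g ->
  (\forall x \ae mu, f x = g x) -> \int[mu]_x f x = \int[mu]_x g x.
Proof.
move=> mf mg fg; rewrite /Rintegral; congr fine.
apply: ae_eq_integral => //; [exact/measurable_EFinP|exact/measurable_EFinP|].
by apply: filterS fg => x + _ => ->.
Qed.

(** Integrability excludes the infinite values, which [fine] would send to 0. *)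
Lemma Rintegral_integrable_fin (f : T -> R) : mu.-integrable setT (EFin \o f) ->
  (\int[mu]_x (f x)%:E = (\int[mu]_x f x)%:E)%E.
Proof. by move=> If; rewrite fineK// integrable_fin_num. Qed.

Lemma ae_integrable (f g : T -> R) :
  measurable_fun setT g -> (\forall x \ae mu, f x = g x) ->
  mu.-integrable setT (EFin \o f) -> mu.-integrable setT (EFin \o g).
Proof.
move=> mg fg /integrableP[/measurable_EFinP mf foo]; apply/integrableP; split.
  exact/measurable_EFinP.
rewrite (_ : (\int[mu]_x _ = \int[mu]_x `|(EFin \o f) x|)%E)//.
apply: ae_eq_integral => //.
- exact/measurableT_comp/measurable_EFinP.
- exact/measurableT_comp/measurable_EFinP.
- by apply: filterS fg => x + _ /= => ->.
Qed.

Lemma Lfun2P (f : T -> R) : f \in Lfun mu 2%:E <->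
  measurable_fun setT f /\ (\int[mu]_x (f x ^+ 2)%:E < +oo)%E.
Proof.
split=> [f2|[mf f2]].
  split; first by move: f2 => /[!inE] /andP[/[!inE]].
  by have /integrable_lty := Lfun2_integrable_sqr f2; apply.
rewrite inE; apply/andP; split; rewrite inE//= /finite_norm unlock poweR_lty//.
rewrite (eq_integral (fun x => (f x ^+ 2)%:E))// => x _ /=.
by congr EFin; rewrite -[2]/(2%:R) powR_mulrn// real_normK ?num_real.
Qed.

Lemma Lfun2_measurable (f : T -> R) : f \in Lfun mu 2%:E -> measurable_fun setT f.
Proof. by case/Lfun2P. Qed.

Lemma Lfun2_le_ae (f g : T -> R) : measurable_fun setT f ->
  (\forall x \ae mu, `|f x| <= `|g x|) -> g \in Lfun mu 2%:E -> f \in Lfun mu 2%:E.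
Proof.
move=> mf fg /Lfun2P[mg g2]; apply/Lfun2P; split=> //.
apply: le_lt_trans g2; apply: ae_ge0_le_integral => //.
- by move=> x _; rewrite lee_fin sqr_ge0.
- exact/measurable_EFinP/measurable_funX.
- by move=> x _; rewrite lee_fin sqr_ge0.
- exact/measurable_EFinP/measurable_funX.
apply: filterS fg => x fgx _; rewrite lee_fin.
by rewrite -[leLHS]real_normK ?num_real// -[leRHS]real_normK ?num_real// lerXn2r.
Qed.

Lemma Lfun2_mul_integrable (f g : T -> R) :
  f \in Lfun mu 2%:E -> g \in Lfun mu 2%:E ->
  mu.-integrable setT (EFin \o (fun x => f x * g x)).
Proof. by move=> f2 g2; apply/Lfun1_integrable/Lfun2_mul_Lfun1. Qed.

Lemma Lfun2D (f g : T -> R) : f \in Lfun mu 2%:E -> g \in Lfun mu 2%:E ->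
  (fun x => f x + g x) \in Lfun mu 2%:E.
Proof.
have [_ S] := @Lfun_submod_closed d T R mu 2%:E (lee1n 2).
by move=> f2 g2; rewrite (_ : (fun _ => _) = 1 *: f + g)//; [exact: S|rewrite scale1r].
Qed.

Lemma Lfun2Z a (f : T -> R) : f \in Lfun mu 2%:E ->
  (fun x => a * f x) \in Lfun mu 2%:E.
Proof.
have [S0 S] := @Lfun_submod_closed d T R mu 2%:E (lee1n 2).
by move=> f2; rewrite (_ : (fun _ => _) = a *: f + 0)//; [exact: S|rewrite addr0].
Qed.

Lemma Lfun2N (f : T -> R) : f \in Lfun mu 2%:E -> (fun x => - f x) \in Lfun mu 2%:E.
Proof.
by move=> /(Lfun2Z (-1)); under eq_fun do rewrite mulN1r.
Qed.

End ae_Rintegral.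

(** * Integrals of real or complex functions *)

Section integral_scalar_theory.
Context {R : realType} {k : scalar_kind} {d} {T : measurableType d}.
Variable mu : {measure set T -> \bar R}.
Local Notation K := (scalars R k).
Implicit Types f g : T -> K.

Definition measurable_scalar f :=
  measurable_fun setT (re \o f) /\ measurable_fun setT (im \o f).

Lemma re_integral f : re (integral_scalar mu f) = \int[mu]_x re (f x).
Proof. by rewrite re_mk. Qed.

Lemma im_integral f : im (integral_scalar mu f) = \int[mu]_x im (f x).
Proof.
rewrite /integral_scalar; move: f; rewrite /im /mk_scalar /re; case: k => //= f.
by rewrite /Rintegral integral0.
Qed.

Lemma integrable_scalarZD (a : K) f g :
  integrable_scalar mu f -> integrable_scalar mu g ->
  integrable_scalar mu (fun x => a * f x + g x).
Proof.
move=> [rf mf] [rg mg]; split.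
  rewrite [X in mu.-integrable _ X](_ : _ = fun x => (re a)%:E * (EFin \o (re \o f)) x +
     ((- im a)%:E * (EFin \o (im \o f)) x + (EFin \o (re \o g)) x))%E.
    by apply: integrableD => //; [|apply: integrableD => //]; exact: integrableZl.
  by apply/funext => x /=; rewrite reD reM -!EFinM -!EFinD mulNr addrA.
rewrite [X in mu.-integrable _ X](_ : _ = fun x => (re a)%:E * (EFin \o (im \o f)) x +
     ((im a)%:E * (EFin \o (re \o f)) x + (EFin \o (im \o g)) x))%E.
  by apply: integrableD => //; [|apply: integrableD => //]; exact: integrableZl.
by apply/funext => x /=; rewrite imD imM -!EFinM -!EFinD addrA.
Qed.

Lemma integral_scalarZD (a : K) f g :
  integrable_scalar mu f -> integrable_scalar mu g ->
  integral_scalar mu (fun x => a * f x + g x) =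
  a * integral_scalar mu f + integral_scalar mu g.
Proof.
have IZ (c : R) (u : T -> R) : mu.-integrable setT (EFin \o u) ->
    mu.-integrable setT (EFin \o (fun x => c * u x)).
  by move=> Iu; exact: (integrableZl measurableT c Iu).
have ID (u v : T -> R) : mu.-integrable setT (EFin \o u) ->
    mu.-integrable setT (EFin \o v) ->
    mu.-integrable setT (EFin \o (fun x => u x + v x)).
  by move=> Iu Iv; exact: (integrableD measurableT Iu Iv).
move=> [rf mf] [rg mg]; apply: scalar_ext.
  rewrite reD reM !(re_integral, im_integral).
  under eq_Rintegral do rewrite reD reM -mulNr -addrA.
  rewrite RintegralD//; [|exact: IZ|by apply: ID => //; exact: IZ].
  by rewrite RintegralD//; [|exact: IZ]; rewrite !RintegralZl// mulNr addrA.
rewrite imD imM !(re_integral, im_integral).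
under eq_Rintegral do rewrite imD imM -addrA.
rewrite RintegralD//; [|exact: IZ|by apply: ID => //; exact: IZ].
by rewrite RintegralD//; [|exact: IZ]; rewrite !RintegralZl// addrA.
Qed.

Lemma ae_eq_integral_scalar f g : measurable_scalar f -> measurable_scalar g ->
  (\forall x \ae mu, f x = g x) -> integral_scalar mu f = integral_scalar mu g.
Proof.
move=> [rf mf] [rg mg] fg; apply: scalar_ext; rewrite !(re_integral, im_integral).
  by apply: ae_eq_Rintegral => //; apply: filterS fg => x ->.
by apply: ae_eq_Rintegral => //; apply: filterS fg => x ->.
Qed.

Lemma ae_integrable_scalar f g : measurable_scalar g ->
  (\forall x \ae mu, f x = g x) -> integrable_scalar mu f -> integrable_scalar mu g.
Proof.
move=> [rg mg] fg [rf mf]; split.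
  by apply: ae_integrable rf => //; apply: filterS fg => x /= ->.
by apply: ae_integrable mf => //; apply: filterS fg => x /= ->.
Qed.

Lemma integral_scalar_conj f : integrable_scalar mu f ->
  integral_scalar mu (fun x => conj (f x)) = conj (integral_scalar mu f).
Proof.
move=> [rf mf]; apply: scalar_ext; rewrite !(re_conj, im_conj, re_integral, im_integral).
  by apply: eq_Rintegral => x _; rewrite re_conj.
under eq_Rintegral do rewrite im_conj -mulN1r.
by rewrite RintegralZl// mulN1r.
Qed.

Lemma square_integrableP f : f \in square_integrable mu <->
  re \o f \in Lfun mu 2%:E /\ im \o f \in Lfun mu 2%:E.
Proof. by rewrite inE; split=> [/andP//|[? ?]]; apply/andP. Qed.

Lemma square_integrable_measurable f : f \in square_integrable mu ->
  measurable_scalar f.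
Proof. by case/square_integrableP => /Lfun2_measurable ? /Lfun2_measurable. Qed.

Lemma integrable_scalar_conjM f g :
  f \in square_integrable mu -> g \in square_integrable mu ->
  integrable_scalar mu (fun x => f x * conj (g x)).
Proof.
move=> /square_integrableP[rf mf] /square_integrableP[rg mg]; split.
  rewrite [X in mu.-integrable _ X](_ : _ =
      (EFin \o (fun x => (re (f x) * re (g x))%R)) \+
      (EFin \o (fun x => (im (f x) * im (g x))%R)))%E.
    by apply: integrableD => //; exact: Lfun2_mul_integrable.
  by apply/funext => x /=; rewrite reM re_conj im_conj mulrN opprK EFinD.
rewrite [X in mu.-integrable _ X](_ : _ =
    (EFin \o (fun x => (im (f x) * re (g x))%R)) \-
    (EFin \o (fun x => (re (f x) * im (g x))%R)))%E.
  by apply: integrableB => //; exact: Lfun2_mul_integrable.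
by apply/funext => x /=; rewrite imM re_conj im_conj mulrN -EFinB addrC.
Qed.

End integral_scalar_theory.

(** * The inner product of L^2 *)

Lemma sqr_le_discriminant {R : realType} (a b c : R) :
  (forall t, 0 <= a - t * b *+ 2 + t ^+ 2 * c) -> 0 <= c -> b ^+ 2 <= a * c.
Proof.
move=> h; rewrite le_eqVlt => /predU1P[c0|c0].
  rewrite -c0 mulr0.
  have [->|b0] := eqVneq b 0; first by rewrite expr0n.
  (* For [c = 0] the polynomial is affine in [t], and at this point it takes the value
     [a - (a + 1) = -1]. *)
  have := h ((a + 1) / (b *+ 2)).
  rewrite -c0 mulr0 addr0 -mulrnAr divfK ?mulrn_eq0//.
  by rewrite opprD addrA subrr sub0r oppr_ge0 ler10.
(* [b / c] is the minimiser of the polynomial, with minimum [a - b ^+ 2 / c]. *)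
have := h (b / c); have c1 := gt_eqF c0.
rewrite expr_div_n -(@ler_pM2r _ c)// mul0r mulrDl mulrBl mulr2n mulrDl.
rewrite [X in _ - (X + X)](_ : _ = b ^+ 2); last by rewrite mulrAC divfK ?c1// expr2.
rewrite [X in _ + X](_ : _ = b ^+ 2); last by rewrite -mulrA -expr2 divfK// expf_eq0 c1.
by rewrite opprD addrA addrNK subr_ge0.
Qed.

Section L2_theory.
Context {R : realType} {k : scalar_kind} {d} {T : measurableType d}.
Variable mu : {measure set T -> \bar R}.
Local Notation K := (scalars R k).
Implicit Types f g h : L2 k mu.
Local Open Scope quotient_scope.

Lemma L2_repr_square f : (L2_repr f : T -> K^o) \in square_integrable mu.
Proof. exact: L2fun_valP. Qed.

Lemma L2_class_eqP (u v : L2fun k mu) :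
  L2_class u = L2_class v <-> \forall x \ae mu, u x = v x.
Proof.
have -> : (L2_class u = L2_class v) = (u - v \in L2null k mu : Prop).
  rewrite Quotient.idealrBE; apply/propext; split=> [/eqP//|/eqP//].
split=> [/asboolP uv|uv].
  by apply: filterS uv => x /= /subr0_eq.
by apply/asboolP; apply: filterS uv => x /= uv; apply/eqP; rewrite subr_eq0; apply/eqP.
Qed.

Lemma L2_classK f : L2_class (repr f) = f.
Proof. exact: reprK. Qed.

Lemma L2_repr_class (u : L2fun k mu) : \forall x \ae mu, L2_repr (L2_class u) x = u x.
Proof. by apply/L2_class_eqP; rewrite L2_classK. Qed.

Lemma L2_eqP f g : f = g <-> \forall x \ae mu, L2_repr f x = L2_repr g x.
Proof. by rewrite -[f in X in X <-> _]L2_classK -[g in X in X <-> _]L2_classK L2_class_eqP. Qed.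

Lemma L2_repr0 : \forall x \ae mu, L2_repr (0 : L2 k mu) x = 0.
Proof.
have -> : (0 : L2 k mu) = L2_class 0 by rewrite /L2_class raddf0.
exact: L2_repr_class.
Qed.

Lemma L2_reprZD (a : K) f g :
  \forall x \ae mu, L2_repr (a *: f + g) x = a * L2_repr f x + L2_repr g x.
Proof.
have -> : a *: f + g = L2_class (a *: (repr f : L2fun k mu) + repr g).
  rewrite /L2_class raddfD/= reprK; congr (_ + _).
exact: L2_repr_class.
Qed.

Lemma integrable_scalar_measurable (u : T -> K) :
  integrable_scalar mu u -> measurable_scalar u.
Proof.
move=> [/measurable_int ? /measurable_int ?].
by split; exact/measurable_EFinP.
Qed.

Lemma inner_integrable f g :
  integrable_scalar mu (fun x => L2_repr f x * conj (L2_repr g x)).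
Proof. by apply: integrable_scalar_conjM; exact: L2_repr_square. Qed.

Lemma innerZDl (a : K) f g h : inner (a *: f + g) h = a * inner f h + inner g h.
Proof.
rewrite /inner -integral_scalarZD; [|exact: inner_integrable..].
apply: ae_eq_integral_scalar.
- exact/integrable_scalar_measurable/inner_integrable.
- by apply/integrable_scalar_measurable/integrable_scalarZD; exact: inner_integrable.
- by apply: filterS (L2_reprZD a f g) => x ->; rewrite mulrDl mulrA.
Qed.

Lemma inner_conj f g : inner g f = conj (inner f g).
Proof.
rewrite /inner -integral_scalar_conj; last exact: inner_integrable.
by congr integral_scalar; apply/funext => x; rewrite conjM conjK mulrC.
Qed.

Lemma inner0l h : inner 0 h = 0.
Proof.
have := innerZDl 1 0 0 h; rewrite scaler0 addr0 mul1r => /esym/eqP.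
by rewrite -subr_eq0 addrK => /eqP.
Qed.

Lemma innerDl f g h : inner (f + g) h = inner f h + inner g h.
Proof. by rewrite -[f in LHS]scale1r innerZDl mul1r. Qed.

Lemma innerZl (a : K) f h : inner (a *: f) h = a * inner f h.
Proof. by rewrite -[X in inner X]addr0 innerZDl inner0l addr0. Qed.

Lemma innerBl f g h : inner (f - g) h = inner f h - inner g h.
Proof. by rewrite innerDl -scaleN1r innerZl mulN1r. Qed.

Lemma innerDr h f g : inner h (f + g) = inner h f + inner h g.
Proof. by rewrite inner_conj innerDl conjD -!inner_conj. Qed.

Lemma innerBr h f g : inner h (f - g) = inner h f - inner h g.
Proof.
rewrite inner_conj innerBl conjD -inner_conj; congr (_ + _).
by rewrite [inner h g]inner_conj; apply: scalar_ext; rewrite !(re_conj, im_conj, reN, imN).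
Qed.

Lemma innerZr (a : K) f h : inner h (a *: f) = conj a * inner h f.
Proof. by rewrite inner_conj innerZl conjM -inner_conj. Qed.

Lemma inner0r h : inner h 0 = 0.
Proof. by rewrite inner_conj inner0l conj0. Qed.

Lemma re_innerC f g : re (inner f g) = re (inner g f).
Proof. by rewrite inner_conj re_conj. Qed.

Lemma re_mul_conj (x : K) : re (x * conj x) = re x ^+ 2 + im x ^+ 2.
Proof. by rewrite reM re_conj im_conj mulrN opprK. Qed.

Lemma re_inner_class (u : L2fun k mu) :
  re (inner (L2_class u) (L2_class u)) = \int[mu]_x (re (u x) ^+ 2 + im (u x) ^+ 2).
Proof.
rewrite re_integral; apply: ae_eq_Rintegral.
- by case: (integrable_scalar_measurable (inner_integrable (L2_class u) (L2_class u))).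
- have [mr mi] := square_integrable_measurable (L2fun_valP u).
  by apply: measurable_funD; exact: measurable_funX.
by apply: filterS (L2_repr_class u) => x ->; rewrite re_mul_conj.
Qed.

Lemma re_innerE f : re (inner f f) =
  \int[mu]_x (re (L2_repr f x) ^+ 2) + \int[mu]_x (im (L2_repr f x) ^+ 2).
Proof.
have /square_integrableP[rf mf] := L2_repr_square f.
rewrite re_integral -RintegralD//; [|exact: Lfun2_integrable_sqr..].
by apply: eq_Rintegral => x _; rewrite re_mul_conj.
Qed.

Lemma re_inner_ge0 f : 0 <= re (inner f f).
Proof.
rewrite re_integral; apply: Rintegral_ge0 => x _.
by rewrite re_mul_conj addr_ge0// sqr_ge0.
Qed.

Lemma L2norm_ge0 f : 0 <= L2norm f.
Proof. exact: sqrtr_ge0. Qed.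

Lemma sqr_L2norm f : L2norm f ^+ 2 = re (inner f f).
Proof. by rewrite sqr_sqrtr// re_inner_ge0. Qed.

Lemma inner_eq0 f : inner f f = 0 -> f = 0.
Proof.
move=> /(congr1 re); rewrite re0 re_integral => f0.
have [If _] := inner_integrable f f.
have : ae_eq mu setT (EFin \o (fun x => re (L2_repr f x * conj (L2_repr f x)))) (cst 0%E).
  apply/ae_eq_integral_abs => //; first exact: measurable_int If.
  rewrite -[RHS]/(0%:E) -f0 -Rintegral_integrable_fin//.
  apply: eq_integral => x _; rewrite /= ger0_norm//.
  by rewrite re_mul_conj addr_ge0// sqr_ge0.
move=> f0x; apply/L2_eqP.
have {}f0x : \forall x \ae mu, re (L2_repr f x * conj (L2_repr f x)) = 0.
  by apply: filterS f0x => x /(_ I) /= [].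
apply: filterS2 L2_repr0 f0x => x ->.
rewrite re_mul_conj => /eqP; rewrite paddr_eq0 ?sqr_ge0// !sqrf_eq0 => /andP[/eqP r0 /eqP i0].
by apply: scalar_ext; rewrite ?re0 ?im0.
Qed.

(** Cauchy-Schwarz for the real part: the squared norm of [f - t g] for real [t] is a nonnegative
    quadratic polynomial in [t], whose middle coefficient contains only the real part of the inner
    product. *)
Lemma re_inner_le f g : `|re (inner f g)| <= L2norm f * L2norm g.
Proof.
rewrite -(@ler_pXn2r _ 2)// ?nnegrE ?normr_ge0 ?mulr_ge0 ?L2norm_ge0//.
rewrite exprMn !sqr_L2norm real_normK ?num_real//.
apply: sqr_le_discriminant; last exact: re_inner_ge0.
move=> t; have := re_inner_ge0 (f - mk_scalar t 0 *: g).
have re_tM (z : K) : re (mk_scalar t 0 * z) = t * re z.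
  by rewrite reM re_mk im_mk0 mul0r subr0.
have -> : inner (f - mk_scalar t 0 *: g) (f - mk_scalar t 0 *: g) =
    inner f f - mk_scalar t 0 * inner f g - (mk_scalar t 0 * inner g f -
      mk_scalar t 0 * (mk_scalar t 0 * inner g g)).
  rewrite innerBl !innerBr !innerZl !innerZr.
  suff -> : conj (mk_scalar t 0 : K) = mk_scalar t 0 by [].
  by apply: scalar_ext; rewrite ?re_conj ?im_conj ?im_mk0 ?oppr0.
rewrite !(reD, reN, re_tM) (re_innerC g f) opprB mulr2n opprD !addrA.
by rewrite addrAC expr2 mulrA.
Qed.

Lemma L2normD f g : L2norm (f + g) <= L2norm f + L2norm g.
Proof.
rewrite -(@ler_pXn2r _ 2)// ?nnegrE ?addr_ge0 ?L2norm_ge0//.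
rewrite sqrrD !sqr_L2norm innerDl !innerDr !reD (re_innerC g f) -!addrA lerD2l.
rewrite !addrA -!mulr2n lerD2r lerMn2r/=.
exact: le_trans (ler_norm _) (re_inner_le _ _).
Qed.

Lemma L2normZ (a : K) f :
  L2norm (a *: f) = scalar_norm a * L2norm f.
Proof.
rewrite /L2norm /scalar_norm innerZl innerZr mulrA -re_mul_conj -sqrtrM.
  congr Num.sqrt; rewrite reM; suff -> : im (a * conj a) = 0 by rewrite mul0r subr0.
  by rewrite imM re_conj im_conj mulrN addrC mulrC subrr.
by rewrite re_mul_conj addr_ge0// sqr_ge0.
Qed.

Lemma L2norm0 : L2norm (0 : L2 k mu) = 0.
Proof. by rewrite /L2norm inner0l re0 sqrtr0. Qed.

End L2_theory.

(** * Iterated integrals of a dual pair *)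

Section integral_like.
Context {R : realType} {d} {T : measurableType d}.
Implicit Types (f g : T -> \bar R) (Phi Psi : (T -> \bar R) -> \bar R).
Local Open Scope ereal_scope.

Definition nonneg_measurable f := measurable_fun setT f /\ forall x, 0 <= f x.

(** The properties of integration against a measure that survive in an iterated integral, seen as a
    functional of one of its arguments. They suffice to recover the functional from its values on
    indicators, by way of simple functions and monotone limits. *)
Record integral_like Phi : Prop := IntegralLike {
  integral_like_ge0 : forall f, nonneg_measurable f -> 0 <= Phi f ;
  integral_like_le : forall f g, nonneg_measurable f -> nonneg_measurable g ->
    (forall x, f x <= g x) -> Phi f <= Phi g ;
  integral_likeD : forall f g, nonneg_measurable f -> nonneg_measurable g ->
    Phi (fun x => f x + g x) = Phi f + Phi g ;
  integral_likeZ : forall (r : R) f, (0 <= r)%R -> nonneg_measurable f ->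
    Phi (fun x => r%:E * f x) = r%:E * Phi f ;
  integral_like_lim : forall u : nat -> T -> \bar R,
    (forall n, nonneg_measurable (u n)) ->
    (forall x, nondecreasing_seq (u ^~ x)) ->
    Phi (fun x => limn (u ^~ x)) = limn (Phi \o u) }.

Lemma nonneg_measurable_indic A : measurable A ->
  nonneg_measurable (EFin \o (\1_A : T -> R)).
Proof. by move=> mA; split=> [|x]; [exact/measurable_EFinP|rewrite lee_fin]. Qed.

Lemma nonneg_measurable_sum (s : seq R) (A : R -> set T) :
  (forall r, measurable (A r)) -> (forall r, r \in s -> (0 <= r)%R) ->
  nonneg_measurable (fun x => (\sum_(r <- s) r * \1_(A r) x)%R%:E).
Proof.
move=> mA s0; split.
  apply/measurable_EFinP; apply: measurable_sum => r.
  exact: measurable_funM.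
by move=> x; rewrite lee_fin big_seq; apply: sumr_ge0 => r /s0 r0; rewrite mulr_ge0.
Qed.

Lemma integral_like_sum Phi (s : seq R) (A : R -> set T) : integral_like Phi ->
  (forall r, measurable (A r)) -> (forall r, r \in s -> (0 <= r)%R) ->
  Phi (fun x => (\sum_(r <- s) r * \1_(A r) x)%R%:E) =
  \sum_(r <- s) r%:E * Phi (EFin \o \1_(A r)).
Proof.
move=> [_ _ PhiD PhiZ _] mA; elim: s => [_|r s ih s0].
  under eq_fun do rewrite big_nil.
  have := PhiZ 0%R _ (lexx _) (nonneg_measurable_indic measurable0).
  by rewrite mul0e => H; rewrite big_nil -[RHS]H; congr Phi; apply/funext => x; rewrite mul0e.
have r0 : (0 <= r)%R by apply: s0; rewrite inE eqxx.
have {}s0 q : q \in s -> (0 <= q)%R by move=> qs; apply: s0; rewrite inE qs orbT.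
rewrite big_cons -ih// -PhiZ//; last exact: nonneg_measurable_indic.
rewrite -PhiD//; last exact: nonneg_measurable_sum.
  by congr Phi; apply/funext => x; rewrite big_cons EFinD EFinM.
have [m1 p1] := nonneg_measurable_indic (mA r).
by split=> [|x]; [exact: measurable_funeM|rewrite mule_ge0].
Qed.

Import HBNNSimple.

Lemma integral_like_ext Phi Psi : integral_like Phi -> integral_like Psi ->
  (forall A, measurable A -> Phi (EFin \o \1_A) = Psi (EFin \o \1_A)) ->
  forall f, nonneg_measurable f -> Phi f = Psi f.
Proof.
move=> PhiL PsiL indicE f [mf f0].
pose f_ := nnsfun_approx measurableT mf.
have mf_ n : nonneg_measurable (EFin \o f_ n).
  by split=> [|x]; [exact/measurable_EFinP|rewrite lee_fin].
have ndf_ x : nondecreasing_seq (fun n => (f_ n x)%:E).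
  by move=> m n mn; rewrite lee_fin; exact/lefP/nd_nnsfun_approx.
have -> : f = fun x => limn (fun n => (f_ n x)%:E).
  by apply/funext => x; apply/esym/cvg_lim => //; exact: cvg_nnsfun_approx.
rewrite (integral_like_lim PhiL mf_ ndf_) (integral_like_lim PsiL mf_ ndf_).
congr (limn _); apply/funext => n /=.
have -> : EFin \o f_ n = fun x =>
    (\sum_(r <- fset_set (range (f_ n))) r * \1_(f_ n @^-1` [set r]) x)%R%:E.
  by apply/funext => x /=; rewrite fimfunE fsbig_finite.
have s0 r : r \in fset_set (range (f_ n)) -> (0 <= r)%R.
  by rewrite in_fset_set// inE => -[x _ <-].
rewrite !integral_like_sum//; apply: eq_bigr => r _; congr (_ * _).
exact: indicE.
Qed.

(** Integration against the Dirac mass at [x]. It makes a plain weighted integral of [f] an instance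
    of [integral_like_integral]. *)
Lemma integral_like_at (x : T) : integral_like (@^~ x).
Proof. by split=> // f [_]; exact. Qed.

Lemma integral_like_measure (mu : {measure set T -> \bar R}) :
  integral_like (fun f => \int[mu]_x f x).
Proof.
split.
- by move=> f [_ f0]; exact: integral_ge0.
- by move=> f g [mf f0] [mg g0] fg; exact: ge0_le_integral.
- by move=> f g [mf f0] [mg g0]; exact: ge0_integralD.
- by move=> r f r0 [mf f0]; exact: ge0_integralZl_EFin.
- move=> u um und; apply: monotone_convergence => //.
  + by move=> n; case: (um n).
  + by move=> n x _; case: (um n).
Qed.

End integral_like.

(** Multiplication of extended reals is continuous except at 0 times infinity. If [w = 0], both
    sides vanish; if the limit is 0, monotonicity and nonnegativity force every [u n] to be 0;
    otherwise the product of the limits is defined. *)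
Lemma mule_lim_nondecreasing {R : realType} (w : \bar R) (u : (\bar R)^nat) :
  (forall n, 0 <= u n)%E -> cvgn u -> nondecreasing_seq u ->
  (w * limn u = limn (fun n => w * u n))%E.
Proof.
move=> u0 cu ndu; have [->|w0] := eqVneq w 0%E.
  rewrite mul0e; apply/esym/cvg_lim => //; under eq_fun do rewrite mul0e; exact: cvg_cst.
have [l0|l0] := eqVneq (limn u) 0%E.
  have uE n : u n = 0%E.
    apply/eqP; rewrite eq_le u0 andbT -l0; apply: lime_ge => //.
    by exists n => // m; exact: ndu.
  rewrite l0 mule0; apply/esym/cvg_lim => //; under eq_fun do rewrite uE mule0; exact: cvg_cst.
apply/esym/cvg_lim => //; apply: cvgeM => //; last exact: cvg_cst.
by rewrite mule_defE (negbTE w0) (negbTE l0).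
Qed.

(** A weighted mixture of measures is again a measure. Both sides of the duality identity have this
    shape, [L x] being either integration against a kernel or evaluation at [x]. *)
Lemma integral_like_integral {R : realType} d d' (S : measurableType d)
    (T : measurableType d') (mu : {measure set S -> \bar R})
    (w : S -> \bar R) (L : S -> (T -> \bar R) -> \bar R) :
  nonneg_measurable w -> (forall x, integral_like (L x)) ->
  (forall f, nonneg_measurable f -> measurable_fun setT (L ^~ f)) ->
  integral_like (fun f => \int[mu]_x (w x * L x f))%E.
Proof.
move=> [mw w0] LL mL.
have wL0 f x : nonneg_measurable f -> (0 <= w x * L x f)%E.
  by move=> mf; rewrite mule_ge0//; exact: integral_like_ge0.
have wLm f : nonneg_measurable f -> measurable_fun setT (fun x => w x * L x f)%E.
  by move=> mf; apply: emeasurable_funM => //; exact: mL.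
have wLle f g x : nonneg_measurable f -> nonneg_measurable g ->
    (forall x, f x <= g x)%E -> (w x * L x f <= w x * L x g)%E.
  by move=> mf mg fg; apply: lee_pmul => //; [exact: integral_like_ge0|exact: integral_like_le].
split.
- by move=> f mf; apply: integral_ge0 => x _; exact: wL0.
- move=> f g mf mg fg; apply: ge0_le_integral => //.
  + by move=> x _; exact: wL0.
  + exact: wLm.
  + exact: wLm.
  + by move=> x _; exact: wLle.
- move=> f g mf mg; rewrite -ge0_integralD//.
  + apply: eq_integral => x _; rewrite (integral_likeD (LL x))//.
    by rewrite ge0_muleDr//; exact: integral_like_ge0.
  + by move=> x _; exact: wL0.
  + exact: wLm.
  + by move=> x _; exact: wL0.
  + exact: wLm.
- move=> r f r0 mf; rewrite -ge0_integralZl_EFin//.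
  + by apply: eq_integral => x _; rewrite (integral_likeZ (LL x))// muleCA.
  + by move=> x _; exact: wL0.
  + exact: wLm.
- move=> u um und; transitivity (\int[mu]_x (limn (fun n => w x * L x (u n))))%E.
    apply: eq_integral => x _; rewrite (integral_like_lim (LL x) um und).
    have cLu : cvgn (fun n => L x (u n)).
      by apply: ereal_nondecreasing_is_cvgn => m n mn; apply: integral_like_le => // y; exact: und.
    apply: mule_lim_nondecreasing => //.
      by move=> n; exact: integral_like_ge0.
    by move=> m n mn; apply: integral_like_le => // y; exact: und.
  apply: monotone_convergence => //.
  + by move=> n; exact: wLm.
  + by move=> n x _; exact: wL0.
  + move=> x _ m n mn; apply: wLle => //.
    by move=> y; exact: und.
Qed.

(** * Duality for nonnegative functions and transfer of null sets *)

Section dual_pairs.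
Context {R : realType} {d1 d2 : measure_display}.
Context {X1 : measurableType d1} {X2 : measurableType d2}.
Variables (nu1 : {measure set X1 -> \bar R}) (nu2 : {measure set X2 -> \bar R}).

Definition kernel_measurable {d d'} {X : measurableType d} {Y : measurableType d'}
    (P : X -> {measure set Y -> \bar R}) :=
  forall U, measurable U -> measurable_fun setT (P ^~ U).

Variables (P : X1 -> {measure set X2 -> \bar R}) (Q : X2 -> {measure set X1 -> \bar R}).
Hypotheses (mP : kernel_measurable P) (mQ : kernel_measurable Q).
Hypothesis PQ : dual_pair nu1 nu2 P Q.

(** The extension from rectangles is done twice: [indicP] freezes [f] as the indicator of [A] and
    lets [g] vary, and then [g] is frozen and [f] varies. Each time both sides are [integral_like]
    in the free function, and only the comparison on indicators remains. *)
Lemma dual_integral (f : X1 -> \bar R) (g : X2 -> \bar R) :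
  nonneg_measurable f -> nonneg_measurable g ->
  (\int[nu1]_x (f x * \int[P x]_y g y) = \int[nu2]_y (g y * \int[Q y]_x f x))%E.
Proof.
move=> mf mg.
have mPi h : nonneg_measurable h -> measurable_fun setT (fun x => \int[P x]_y h y)%E.
  by move=> [mh h0]; exact: measurable_fun_integral_kernel.
have mQi h : nonneg_measurable h -> measurable_fun setT (fun y => \int[Q y]_x h x)%E.
  by move=> [mh h0]; exact: measurable_fun_integral_kernel.
have indicP A : measurable A -> (\int[nu1]_x ((\1_A x)%:E * \int[P x]_y g y) =
    \int[nu2]_y (g y * \int[Q y]_x (\1_A x)%:E))%E.
  move=> mA; have [mQA QA0] : nonneg_measurable (fun y => \int[Q y]_x (\1_A x)%:E)%E.
    split; first exact/mQi/nonneg_measurable_indic.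
    by move=> y; apply: integral_ge0 => x _; rewrite lee_fin.
  pose Psi h := (\int[nu2]_y ((\int[Q y]_x (\1_A x)%:E) * h y))%E.
  transitivity (Psi g); last by apply: eq_integral => y _; rewrite muleC.
  move: g mg; apply: integral_like_ext.
  - apply: integral_like_integral => //; first exact: nonneg_measurable_indic.
    by move=> x; exact: integral_like_measure.
  - apply: (integral_like_integral nu2 _ (fun y => integral_like_at y)) => //.
    by move=> h [].
  - move=> B mB; rewrite /Psi.
    transitivity (\int[nu1]_x P x (xsection (A `*` B) x))%E.
      apply: eq_integral => x _; rewrite integral_indic// setIT indicE.
      have [xA|xA] := boolP (x \in A); first by rewrite mul1e in_xsectionX.
      by rewrite mul0e notin_xsectionX.
    rewrite PQ; last exact: measurableX.
    apply: eq_integral => y _; rewrite integral_indic// setIT/= indicE.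
    have [yB|yB] := boolP (y \in B); first by rewrite mule1 in_ysectionX.
    by rewrite mule0 notin_ysectionX.
pose Phi h := (\int[nu1]_x ((\int[P x]_y g y) * h x))%E.
transitivity (Phi f); first by apply: eq_integral => x _; rewrite muleC.
have [mPg Pg0] : nonneg_measurable (fun x => \int[P x]_y g y)%E.
  split; first exact: mPi.
  by move=> x; apply: integral_ge0 => y _; case: mg.
move: f mf; apply: integral_like_ext.
- apply: (integral_like_integral nu1 _ (fun x => integral_like_at x)) => //.
  by move=> h [].
- apply: integral_like_integral => //.
  by move=> x; exact: integral_like_measure.
- by move=> A mA; rewrite -indicP//; apply: eq_integral => x _; rewrite muleC.
Qed.

Lemma dual_integral1 (g : X2 -> \bar R) : nonneg_measurable g ->
  (\int[nu1]_x \int[P x]_y g y = \int[nu2]_y (g y * Q y setT))%E.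
Proof.
move=> mg; have := @dual_integral (cst 1%E) g; rewrite /cst => H.
transitivity (\int[nu1]_x (1 * \int[P x]_y g y))%E.
  by apply: eq_integral => x _; rewrite mul1e.
rewrite H//.
by apply: eq_integral => y _; rewrite integral_cst// mul1e.
Qed.

Lemma dual_ae (p : X2 -> Prop) : (\forall y \ae nu2, p y) ->
  \forall x \ae nu1, \forall y \ae P x, p y.
Proof.
move=> [N [mN N0 pN]].
have mPN : measurable_fun setT (P ^~ N) by exact: mP.
have : ae_eq nu1 setT (P ^~ N) (cst 0%E).
  apply/ae_eq_integral_abs => //.
  transitivity (\int[nu1]_x \int[P x]_y (\1_N y)%:E)%E.
    by apply: eq_integral => x _; rewrite integral_indic// setIT gee0_abs.
  rewrite dual_integral1; last exact: nonneg_measurable_indic.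
  transitivity (\int[nu2]_(y in N) Q y setT)%E.
    rewrite [RHS]integral_mkcond; apply: eq_integral => y _.
    by rewrite patchE indicE; case: ifP; rewrite (mul1e, mul0e).
  by apply: null_set_integral => //; apply: measurable_funTS; exact: mQ.
by apply: filterS => x /(_ I) PN0; exists N.
Qed.

End dual_pairs.

(** Through this swap every result about [P] also gives the one about [Q]. *)
Lemma dual_pair_sym {R : realType} {d1 d2 : measure_display}
    {X1 : measurableType d1} {X2 : measurableType d2}
    (nu1 : {measure set X1 -> \bar R}) (nu2 : {measure set X2 -> \bar R})
    (P : X1 -> {measure set X2 -> \bar R}) (Q : X2 -> {measure set X1 -> \bar R}) :
  dual_pair nu1 nu2 P Q -> dual_pair nu2 nu1 Q P.
Proof.
move=> PQ E mE; pose E' : set (X1 * X2) := (fun z => (z.2, z.1)) @^-1` E.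
have mE' : measurable E'.
  by rewrite -[E']setTI; apply: (@measurable_swap _ _ X1 X2).
exact/esym/(PQ _ mE').
Qed.

(** * Functions that a kernel sends into L^2 *)

Section kernel_domain.
Context {R : realType} {d1 d2 : measure_display}.
Context {X1 : measurableType d1} {X2 : measurableType d2}.
Variables (nu1 : {measure set X1 -> \bar R}) (nu2 : {measure set X2 -> \bar R}).
Variables (P : X1 -> {measure set X2 -> \bar R}) (Q : X2 -> {measure set X1 -> \bar R}).
Hypotheses (mP : kernel_measurable P) (mQ : kernel_measurable Q).
Hypothesis PQ : dual_pair nu1 nu2 P Q.

(** Integrability is a clause of its own because the real integral in the last clause would be 0,
    hence harmless, at points where it diverges. The absolute value makes the domain stable under
    domination, in particular under passage to positive and negative parts. *)
Definition kernel_dom (u : X2 -> R) : Prop :=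
  [/\ measurable_fun setT u, \forall x \ae nu1, (P x).-integrable setT (EFin \o u)
    & (fun x => \int[P x]_y `|u y|) \in Lfun nu1 2%:E].

Lemma measurable_fun_Rintegral_kernel (u : X2 -> R) : measurable_fun setT u ->
  measurable_fun setT (fun x => \int[P x]_y u y).
Proof.
move=> mu; apply: measurableT_comp => //.
under eq_fun do rewrite integralE.
have mu' : measurable_fun setT (EFin \o u) by exact/measurable_EFinP.
apply: emeasurable_funB; apply: measurable_fun_integral_kernel => //.
  exact: measurable_funepos.
exact: measurable_funeneg.
Qed.

(** The domination is known only off a [nu2]-null set; [dual_ae] turns it into domination
    [P x]-almost everywhere for [nu1]-almost every [x], where the integrals can be compared. *)
Lemma kernel_dom_le (u v : X2 -> R) : measurable_fun setT u ->
  (\forall y \ae nu2, `|u y| <= `|v y|) -> kernel_dom v -> kernel_dom u.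
Proof.
move=> mu uv [mv Iv v2].
have Iu : \forall x \ae nu1, (P x).-integrable setT (EFin \o u).
  apply: filterS2 (dual_ae mP mQ PQ uv) Iv => x uvx /integrableP[_ vx].
  apply/integrableP; split; first exact/measurable_EFinP.
  apply: le_lt_trans vx; apply: ae_ge0_le_integral => //.
  - exact/measurableT_comp/measurable_EFinP.
  - exact/measurableT_comp/measurable_EFinP.
  - by apply: filterS uvx => y uvy _; rewrite /= lee_fin.
split=> //; apply: Lfun2_le_ae v2.
  by apply: measurable_fun_Rintegral_kernel; exact: measurableT_comp.
apply: filterS3 (dual_ae mP mQ PQ uv) Iv Iu => x uvx Ivx Iux.
rewrite !ger0_norm ?Rintegral_ge0// /Rintegral fine_le//.
- by apply: integrable_fin_num => //; exact: integrable_norm.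
- by apply: integrable_fin_num => //; exact: integrable_norm.
- apply: ae_ge0_le_integral => //.
  + exact/measurable_EFinP/measurableT_comp.
  + exact/measurable_EFinP/measurableT_comp.
  + by apply: filterS uvx => y uvy _; rewrite /= lee_fin.
Qed.

Lemma kernel_domZD a (u v : X2 -> R) : kernel_dom u -> kernel_dom v ->
  kernel_dom (fun y => a * u y + v y).
Proof.
move=> [mu Iu u2] [mv Iv v2].
have muv : measurable_fun setT (fun y => a * u y + v y).
  by apply: measurable_funD => //; exact: measurable_funM.
have Iuv : \forall x \ae nu1, (P x).-integrable setT (EFin \o (fun y => a * u y + v y)).
  apply: filterS2 Iu Iv => x Iux Ivx.
  exact: (integrableD measurableT (integrableZl measurableT a Iux) Ivx).
split=> //.
apply: Lfun2_le_ae (Lfun2D (Lfun2Z `|a| u2) v2).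
  by apply: measurable_fun_Rintegral_kernel; exact: measurableT_comp.
apply: filterS3 Iu Iv Iuv => x Iux Ivx Iuvx.
have Iu' := integrable_norm Iux; have Iv' := integrable_norm Ivx.
have Iau' : (P x).-integrable setT (EFin \o (fun y => `|a| * `|u y|)).
  exact: (integrableZl measurableT `|a| Iu').
rewrite ger0_norm ?Rintegral_ge0// ger0_norm ?addr_ge0 ?mulr_ge0 ?Rintegral_ge0//.
have <- := RintegralZl `|a| measurableT Iu'.
have <- := RintegralD measurableT Iau' Iv'.
apply: le_Rintegral => //.
- exact: integrable_norm.
- exact: (integrableD measurableT Iau' Iv').
- by move=> y _; rewrite -normrM ler_normD.
Qed.

Lemma kernel_dom_Lfun (u : X2 -> R) : kernel_dom u ->
  (fun x => \int[P x]_y u y) \in Lfun nu1 2%:E.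
Proof.
move=> [mu Iu u2]; apply: Lfun2_le_ae u2; first exact: measurable_fun_Rintegral_kernel.
apply: filterS Iu => x Iux; rewrite [leRHS]ger0_norm ?Rintegral_ge0//.
exact: le_normr_Rintegral.
Qed.

End kernel_domain.

(** * Kernel bilinear forms and duality for signed functions *)

Lemma pos_neg_parts {R : realType} {T : Type} (u : T -> R) :
  u = (fun x => Num.max (u x) 0 - Num.max (- u x) 0).
Proof. by apply/funext => x; case: (leP (u x) 0); case: (leP (- u x) 0); lra. Qed.

Section kernel_form.
Context {R : realType} {d1 d2 : measure_display}.
Context {X1 : measurableType d1} {X2 : measurableType d2}.
Variables (nu1 : {measure set X1 -> \bar R}) (P : X1 -> {measure set X2 -> \bar R}).
Hypothesis mP : kernel_measurable P.

Lemma kernel_form_integrable (u : X2 -> R) (v : X1 -> R) :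
  kernel_dom nu1 P u -> v \in Lfun nu1 2%:E ->
  nu1.-integrable setT (EFin \o (fun x => v x * \int[P x]_y u y)).
Proof. by move=> uP v2; apply: Lfun2_mul_integrable => //; exact: kernel_dom_Lfun. Qed.

Lemma kernel_formBl (u1 u2 : X2 -> R) (v : X1 -> R) :
  kernel_dom nu1 P u1 -> kernel_dom nu1 P u2 -> v \in Lfun nu1 2%:E ->
  \int[nu1]_x (v x * \int[P x]_y (u1 y - u2 y)) =
  \int[nu1]_x (v x * \int[P x]_y u1 y) - \int[nu1]_x (v x * \int[P x]_y u2 y).
Proof.
move=> u1P u2P v2; rewrite -RintegralB//; [|exact: kernel_form_integrable..].
have [mu1 Iu1 _] := u1P; have [mu2 Iu2 _] := u2P; have mv := Lfun2_measurable v2.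
have mPu u : measurable_fun setT u -> measurable_fun setT (fun x => v x * \int[P x]_y u y).
  by move=> mu; apply: measurable_funM => //; exact: measurable_fun_Rintegral_kernel.
apply: ae_eq_Rintegral.
- by apply: mPu; exact: measurable_funB.
- by apply: measurable_funB; exact: mPu.
- by apply: filterS2 Iu1 Iu2 => x Iu1x Iu2x; rewrite RintegralB// mulrBr.
Qed.

Lemma kernel_formBr (u : X2 -> R) (v1 v2 : X1 -> R) :
  kernel_dom nu1 P u -> v1 \in Lfun nu1 2%:E -> v2 \in Lfun nu1 2%:E ->
  \int[nu1]_x ((v1 x - v2 x) * \int[P x]_y u y) =
  \int[nu1]_x (v1 x * \int[P x]_y u y) - \int[nu1]_x (v2 x * \int[P x]_y u y).
Proof.
move=> uP v12 v22; rewrite -RintegralB//; [|exact: kernel_form_integrable..].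
by apply: eq_Rintegral => x _; rewrite mulrBl.
Qed.

(** The bridge to [dual_integral], which speaks of extended integrals: the inner real integral
    agrees with the extended one at every [x] where [u] is integrable, hence almost everywhere. *)
Lemma kernel_form_ge0E (u : X2 -> R) (v : X1 -> R) :
  kernel_dom nu1 P u -> measurable_fun setT v -> (forall y, 0 <= u y) ->
  \int[nu1]_x (v x * \int[P x]_y u y) =
  fine (\int[nu1]_x ((v x)%:E * \int[P x]_y (u y)%:E)).
Proof.
move=> [mu Iu _] mv u0; rewrite /Rintegral; congr fine.
apply: ae_eq_integral => //.
- apply/measurable_EFinP/measurable_funM => //.
  exact: measurable_fun_Rintegral_kernel.
- apply: emeasurable_funM; first exact/measurable_EFinP.
  apply: measurable_fun_integral_kernel => //; exact/measurable_EFinP.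
- by apply: filterS Iu => x Iux _; rewrite Rintegral_integrable_fin.
Qed.

End kernel_form.

Section dual_kernel_forms.
Context {R : realType} {d1 d2 : measure_display}.
Context {X1 : measurableType d1} {X2 : measurableType d2}.
Variables (nu1 : {measure set X1 -> \bar R}) (nu2 : {measure set X2 -> \bar R}).
Variables (P : X1 -> {measure set X2 -> \bar R}) (Q : X2 -> {measure set X1 -> \bar R}).
Hypotheses (mP : kernel_measurable P) (mQ : kernel_measurable Q).
Hypothesis PQ : dual_pair nu1 nu2 P Q.

Lemma dual_kernel_form_ge0 (u : X2 -> R) (v : X1 -> R) :
  kernel_dom nu1 P u -> kernel_dom nu2 Q v ->
  (forall y, 0 <= u y) -> (forall x, 0 <= v x) ->
  \int[nu1]_x (v x * \int[P x]_y u y) = \int[nu2]_y (u y * \int[Q y]_x v x).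
Proof.
move=> uP vQ u0 v0; have [mu _ _] := uP; have [mv _ _] := vQ.
rewrite !kernel_form_ge0E//; congr fine; apply: (dual_integral mP mQ PQ).
  by split=> [|x]; [exact/measurable_EFinP|rewrite lee_fin].
by split=> [|x]; [exact/measurable_EFinP|rewrite lee_fin].
Qed.

Lemma dual_kernel_form (u : X2 -> R) (v : X1 -> R) :
  kernel_dom nu1 P u -> u \in Lfun nu2 2%:E ->
  kernel_dom nu2 Q v -> v \in Lfun nu1 2%:E ->
  \int[nu1]_x (v x * \int[P x]_y u y) = \int[nu2]_y (u y * \int[Q y]_x v x).
Proof.
move=> uP u2 vQ v2.
have QP := dual_pair_sym PQ.
pose up y : R := Num.max (u y) 0; pose un y : R := Num.max (- u y) 0.
pose vp x : R := Num.max (v x) 0; pose vn x : R := Num.max (- v x) 0.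
have [mu mv] := (Lfun2_measurable u2, Lfun2_measurable v2).
have max_le (x : R) : `|Num.max x 0| <= `|x|.
  by case: (leP x 0) => _; rewrite ?normr0 ?normr_ge0.
have mup : measurable_fun setT up by exact: measurable_maxr.
have mun : measurable_fun setT un by apply: measurable_maxr => //; exact: measurableT_comp.
have mvp : measurable_fun setT vp by exact: measurable_maxr.
have mvn : measurable_fun setT vn by apply: measurable_maxr => //; exact: measurableT_comp.
have lup y : `|up y| <= `|u y| by exact: max_le.
have lun y : `|un y| <= `|u y| by rewrite -[leRHS]normrN max_le.
have lvp x : `|vp x| <= `|v x| by exact: max_le.
have lvn x : `|vn x| <= `|v x| by rewrite -[leRHS]normrN max_le.
have upP : kernel_dom nu1 P up by exact: (kernel_dom_le mP mQ PQ mup (aeW nu2 lup) uP).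
have unP : kernel_dom nu1 P un by exact: (kernel_dom_le mP mQ PQ mun (aeW nu2 lun) uP).
have vpQ : kernel_dom nu2 Q vp by exact: (kernel_dom_le mQ mP QP mvp (aeW nu1 lvp) vQ).
have vnQ : kernel_dom nu2 Q vn by exact: (kernel_dom_le mQ mP QP mvn (aeW nu1 lvn) vQ).
have up2 : up \in Lfun nu2 2%:E by apply: Lfun2_le_ae u2 => //; exact: filterE.
have un2 : un \in Lfun nu2 2%:E by apply: Lfun2_le_ae u2 => //; exact: filterE.
have vp2 : vp \in Lfun nu1 2%:E by apply: Lfun2_le_ae v2 => //; exact: filterE.
have vn2 : vn \in Lfun nu1 2%:E by apply: Lfun2_le_ae v2 => //; exact: filterE.
have max0 (x : R) : 0 <= Num.max x 0 by rewrite le_max lexx orbT.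
have uE : u = (fun y => up y - un y) by exact: pos_neg_parts.
have vE : v = (fun x => vp x - vn x) by exact: pos_neg_parts.
(* The function under the kernel is split first on each side, [u] on the left and [v] on the right;
   the outer factor is split afterwards by [formv] and [formu]. *)
transitivity (\int[nu1]_x (v x * \int[P x]_y up y) -
  \int[nu1]_x (v x * \int[P x]_y un y)).
  by rewrite -kernel_formBl// -uE.
transitivity (\int[nu2]_y (u y * \int[Q y]_x vp x) -
  \int[nu2]_y (u y * \int[Q y]_x vn x)); last first.
  by rewrite -kernel_formBl// -vE.
have formv w : kernel_dom nu1 P w -> \int[nu1]_x (v x * \int[P x]_y w y) =
    \int[nu1]_x (vp x * \int[P x]_y w y) - \int[nu1]_x (vn x * \int[P x]_y w y).
  by move=> wP; rewrite vE kernel_formBr.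
have formu w : kernel_dom nu2 Q w -> \int[nu2]_y (u y * \int[Q y]_x w x) =
    \int[nu2]_y (up y * \int[Q y]_x w x) - \int[nu2]_y (un y * \int[Q y]_x w x).
  by move=> wQ; rewrite uE kernel_formBr.
have ge0E := dual_kernel_form_ge0.
rewrite (formv up)// (formv un)// (formu vp)// (formu vn)//.
have e1 := ge0E up vp upP vpQ (fun=> max0 _) (fun=> max0 _).
have e2 := ge0E up vn upP vnQ (fun=> max0 _) (fun=> max0 _).
have e3 := ge0E un vp unP vpQ (fun=> max0 _) (fun=> max0 _).
have e4 := ge0E un vn unP vnQ (fun=> max0 _) (fun=> max0 _).
(* Both sides consist of the same four nonnegative forms with the same signs; only the two mixed
   terms come in opposite order. *)
by rewrite e1 e2 e3 e4 opprD [in RHS]opprD addrACA.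
Qed.

End dual_kernel_forms.

(** * Probability kernels on square-integrable functions *)

Lemma sqr_Rintegral_le {R : realType} {d} {T : measurableType d} (mu : {measure set T -> \bar R})
    (u : T -> R) : mu setT = 1%E -> u \in Lfun mu 2%:E ->
  (\int[mu]_x u x) ^+ 2 <= \int[mu]_x (u x ^+ 2).
Proof.
move=> mu1 u2.
have Iu : mu.-integrable setT (EFin \o u).
  by apply/Lfun1_integrable; apply: Lfun_subset12 u2; rewrite mu1.
have Iu2 := Lfun2_integrable_sqr u2.
set m := \int[mu]_x u x.
have Icst : mu.-integrable setT (EFin \o cst (m ^+ 2)).
  apply/integrableP; split; first exact/measurable_EFinP.
  rewrite (eq_integral (cst (`|m ^+ 2|)%:E))//.
  by rewrite integral_cst// mu1 mule1 ltry.
have Imu : mu.-integrable setT (EFin \o (fun x => (m *+ 2) * u x)).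
  exact: (integrableZl measurableT _ Iu).
have ID : mu.-integrable setT (EFin \o (fun x => u x ^+ 2 - m *+ 2 * u x)).
  exact: (integrableB measurableT Iu2 Imu).
(* The integrand is [(u x - m) ^+ 2], so this is the nonnegativity of the variance; it is kept
   expanded so that linearity applies termwise. *)
have : 0 <= \int[mu]_x ((u x ^+ 2 - m *+ 2 * u x) + m ^+ 2).
  by apply: Rintegral_ge0 => x _; have := sqr_ge0 (u x - m); lra.
rewrite RintegralD// RintegralB// RintegralZl// Rintegral_cst// mu1/= -/m mulr1.
by rewrite mulr2n mulrDl -expr2 opprD addrA addrNK subr_ge0.
Qed.

Section probability_kernels.
Context {R : realType} {d1 d2 : measure_display}.
Context {X1 : measurableType d1} {X2 : measurableType d2}.
Variables (nu1 : {measure set X1 -> \bar R}) (nu2 : {measure set X2 -> \bar R}).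
Variables (P : X1 -> {measure set X2 -> \bar R}) (Q : X2 -> {measure set X1 -> \bar R}).
Hypotheses (mP : kernel_measurable P) (mQ : kernel_measurable Q).
Hypothesis PQ : dual_pair nu1 nu2 P Q.
Hypotheses (P1 : forall x, P x setT = 1%E) (Q1 : forall y, Q y setT = 1%E).

(** As [Q y] has mass 1, the second marginal of the common measure is [nu2] itself: [P] transports
    [nu1] to [nu2]. *)
Lemma dual_integral_sqr (u : X2 -> R) : measurable_fun setT u ->
  (\int[nu1]_x \int[P x]_y (u y ^+ 2)%:E = \int[nu2]_y (u y ^+ 2)%:E)%E.
Proof.
move=> mu; rewrite (dual_integral1 mP mQ PQ); last first.
  by split=> [|y]; [exact/measurable_EFinP/measurable_funX|rewrite lee_fin sqr_ge0].
by apply: eq_integral => y _; rewrite Q1 mule1.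
Qed.

(** The integral of [u ^+ 2] against [P x] has finite [nu1]-integral in [x], so it is finite for
    almost every [x]. *)
Lemma ae_Lfun_kernel (u : X2 -> R) : u \in Lfun nu2 2%:E ->
  \forall x \ae nu1, u \in Lfun (P x) 2%:E.
Proof.
move=> /Lfun2P[mu u2]; rewrite -dual_integral_sqr// in u2.
have : nu1.-integrable setT (fun x => \int[P x]_y (u y ^+ 2)%:E)%E.
  apply/integrableP; split.
    apply: measurable_fun_integral_kernel => //.
      by move=> y; rewrite lee_fin sqr_ge0.
    exact/measurable_EFinP/measurable_funX.
  apply: le_lt_trans u2; rewrite le_eqVlt; apply/orP; left; apply/eqP.
  apply: eq_integral => x _; rewrite gee0_abs//.
  by apply: integral_ge0 => y _; rewrite lee_fin sqr_ge0.
move=> /integrable_ae-/(_ measurableT); apply: filterS => x /(_ I) fx.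
by apply/Lfun2P; split=> //; rewrite -ge0_fin_numE// integral_ge0// => y _; rewrite lee_fin sqr_ge0.
Qed.

Lemma integral_sqr_kernel_le (u : X2 -> R) : u \in Lfun nu2 2%:E ->
  (\int[nu1]_x ((\int[P x]_y u y)%R ^+ 2)%:E <= \int[nu2]_y (u y ^+ 2)%:E)%E.
Proof.
move=> u2; have mu := Lfun2_measurable u2.
rewrite -dual_integral_sqr//; apply: ae_ge0_le_integral => //.
- by move=> x _; rewrite lee_fin sqr_ge0.
- exact/measurable_EFinP/measurable_funX/measurable_fun_Rintegral_kernel.
- by move=> x _; apply: integral_ge0 => y _; rewrite lee_fin sqr_ge0.
- apply: measurable_fun_integral_kernel => //.
    by move=> y; rewrite lee_fin sqr_ge0.
  exact/measurable_EFinP/measurable_funX.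
- apply: filterS (ae_Lfun_kernel u2) => x ux _.
  rewrite Rintegral_integrable_fin; last exact: Lfun2_integrable_sqr.
  by rewrite lee_fin sqr_Rintegral_le.
Qed.

Lemma kernel_dom_probability (u : X2 -> R) : u \in Lfun nu2 2%:E -> kernel_dom nu1 P u.
Proof.
move=> u2; have mu := Lfun2_measurable u2.
have mnu : measurable_fun setT (fun y => `|u y|) by exact: measurableT_comp.
split=> //.
  apply: filterS (ae_Lfun_kernel u2) => x ux; apply/Lfun1_integrable.
  by apply: Lfun_subset12 ux; rewrite P1.
apply/Lfun2P; split; first exact: measurable_fun_Rintegral_kernel.
have nu2' : (fun y => `|u y|) \in Lfun nu2 2%:E.
  by apply: Lfun2_le_ae u2 => //; apply: filterE => y; rewrite normr_id.
by apply: le_lt_trans (integral_sqr_kernel_le nu2') _; case/Lfun2P: nu2'.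
Qed.

End probability_kernels.

(** * Kernel operators on L^2 *)

Section L2_kernel_operators.
Context {R : realType} {k : scalar_kind} {d1 d2 : measure_display}.
Context {X1 : measurableType d1} {X2 : measurableType d2}.
Variables (nu1 : {measure set X1 -> \bar R}) (nu2 : {measure set X2 -> \bar R}).
Variables (P : X1 -> {measure set X2 -> \bar R}) (Q : X2 -> {measure set X1 -> \bar R}).
Hypotheses (mP : kernel_measurable P) (mQ : kernel_measurable Q).
Hypothesis PQ : dual_pair nu1 nu2 P Q.
Local Notation K := (scalars R k).
Implicit Types (f g : L2 k nu2) (h : L2 k nu1) (D : set (L2 k nu2)).

(** The quantifier over representatives collapses to the chosen one: two representatives agree
    [nu2]-almost everywhere, hence [P x]-almost everywhere for almost every [x], and so have the
    same integrals there. *)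
Lemma kernel_operatorP D f h : kernel_operator nu1 nu2 P D (f, h) <->
  D f /\ \forall x \ae nu1, integrable_scalar (P x) (L2_repr f) /\
    L2_repr h x = integral_scalar (P x) (L2_repr f).
Proof.
split=> [[Df fh]|[Df fh]]; split=> //; first exact/fh/L2_classK.
move=> u uf; have {}uf : \forall y \ae nu2, L2_repr f y = u y.
  by rewrite -[f in L2_repr f]uf; exact: L2_repr_class.
have mf := square_integrable_measurable (L2_repr_square f).
have mu := square_integrable_measurable (L2fun_valP u).
apply: filterS2 (dual_ae mP mQ PQ uf) fh => x ufx [fx ->]; split.
  exact: ae_integrable_scalar fx.
exact: ae_eq_integral_scalar.
Qed.

Lemma kernel_operator_is_operator D :
  D 0 -> (forall a f g, D f -> D g -> D (a *: f + g)) ->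
  is_operator (kernel_operator nu1 nu2 P D).
Proof.
move=> D0 DZD; split.
- apply/kernel_operatorP; split=> //.
  have f0 := dual_ae mP mQ PQ (@L2_repr0 _ k _ _ nu2).
  have mf := square_integrable_measurable (L2_repr_square (0 : L2 k nu2)).
  have m0 : measurable_scalar (fun=> 0 : K) by split; exact: measurable_cst.
  apply: filterS2 (@L2_repr0 _ k _ _ nu1) f0 => x -> fx; split.
    apply: (@ae_integrable_scalar _ _ _ _ _ (fun=> 0)) => //.
      by apply: filterS fx => y ->.
    by split; rewrite /comp ?re0 ?im0; exact: integrable0.
  rewrite (@ae_eq_integral_scalar _ _ _ _ _ _ (fun=> 0))//.
  by apply: scalar_ext; rewrite ?re_integral ?im_integral ?re0 ?im0 /Rintegral integral0.
- move=> a [f1 h1] [f2 h2] /kernel_operatorP[Df1 fh1] /kernel_operatorP[Df2 fh2].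
  apply/kernel_operatorP; split; first exact: DZD.
  apply: filterS3 (filterI fh1 fh2) (L2_reprZD a h1 h2) (dual_ae mP mQ PQ (L2_reprZD a f1 f2)).
  move=> x [[If1 hx1] [If2 hx2]] -> fx.
  have If := integrable_scalarZD a If1 If2.
  have mf := square_integrable_measurable (L2_repr_square (a *: f1 + f2)).
  split; first by apply: ae_integrable_scalar If => //; apply: filterS fx => y ->.
  rewrite hx1 hx2 -integral_scalarZD//.
  apply: ae_eq_integral_scalar => //; first exact: integrable_scalar_measurable If.
  by apply: filterS fx => y ->.
- move=> f h h' /kernel_operatorP[_ fh] /kernel_operatorP[_ fh'].
  by apply/L2_eqP; apply: filterS2 fh fh' => x [_ ->] [_ ->].
Qed.

Definition L2_kernel_dom f : Prop :=
  kernel_dom nu1 P (re \o L2_repr f) /\ kernel_dom nu1 P (im \o L2_repr f).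

Lemma kernel_image_square f : L2_kernel_dom f ->
  (fun x => integral_scalar (P x) (L2_repr f) : K^o) \in square_integrable nu1.
Proof.
move=> [rf mf]; apply/square_integrableP; split.
  rewrite (_ : _ \o _ = fun x => \int[P x]_y (re \o L2_repr f) y).
    exact: kernel_dom_Lfun.
  by apply/funext => x; exact: re_integral.
rewrite (_ : _ \o _ = fun x => \int[P x]_y (im \o L2_repr f) y).
  exact: kernel_dom_Lfun.
by apply/funext => x; exact: im_integral.
Qed.

Lemma kernel_operator_ex D f : D f -> L2_kernel_dom f ->
  exists h, kernel_operator nu1 nu2 P D (f, h).
Proof.
move=> Df fP; pose w := L2Fun (kernel_image_square fP); exists (L2_class w).
apply/kernel_operatorP; split=> //; have [[_ rf _] [_ mf _]] := fP.
by apply: filterS3 rf mf (L2_repr_class w) => x rfx mfx ->.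
Qed.

Lemma domain_kernel_operator D : D `<=` L2_kernel_dom ->
  domain (kernel_operator nu1 nu2 P D) = D.
Proof.
move=> DP; apply/seteqP; split=> [f [h [Df _]]//|f Df].
exact: kernel_operator_ex (DP _ Df).
Qed.

(** The coordinates of [h'] times the conjugate of the image of [f]. Each of the four integrals is a
    real kernel form, to which [dual_kernel_form] applies separately. *)
Lemma inner_kernel_operator D f h (h' : L2 k nu1) :
  kernel_operator nu1 nu2 P D (f, h) -> L2_kernel_dom f ->
  inner h' h = mk_scalar
    (\int[nu1]_x (re (L2_repr h' x) * \int[P x]_y re (L2_repr f y)) +
     \int[nu1]_x (im (L2_repr h' x) * \int[P x]_y im (L2_repr f y)))
    (\int[nu1]_x (im (L2_repr h' x) * \int[P x]_y re (L2_repr f y)) -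
     \int[nu1]_x (re (L2_repr h' x) * \int[P x]_y im (L2_repr f y))).
Proof.
move=> /kernel_operatorP[_ fh] fP; have [rfP mfP] := fP.
have /square_integrableP[rh mh] := L2_repr_square h'.
have Ih := integrable_scalar_conjM (L2_repr_square h') (kernel_image_square fP).
transitivity (integral_scalar nu1 (fun x =>
    L2_repr h' x * conj (integral_scalar (P x) (L2_repr f)))).
  apply: ae_eq_integral_scalar.
  - exact: integrable_scalar_measurable (inner_integrable h' h).
  - exact: integrable_scalar_measurable Ih.
  - by apply: filterS fh => x [_ ->].
rewrite /integral_scalar; congr mk_scalar.
  rewrite -RintegralD//; [|exact: kernel_form_integrable..].
  apply: eq_Rintegral => x _.
  by rewrite reM re_conj im_conj re_integral im_integral mulrN opprK.
rewrite -RintegralB//; [|exact: kernel_form_integrable..].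
apply: eq_Rintegral => x _.
by rewrite imM re_conj im_conj re_integral im_integral mulrN addrC.
Qed.

End L2_kernel_operators.

Section dual_kernel_operators.
Context {R : realType} {k : scalar_kind} {d1 d2 : measure_display}.
Context {X1 : measurableType d1} {X2 : measurableType d2}.
Variables (nu1 : {measure set X1 -> \bar R}) (nu2 : {measure set X2 -> \bar R}).
Variables (P : X1 -> {measure set X2 -> \bar R}) (Q : X2 -> {measure set X1 -> \bar R}).
Hypotheses (mP : kernel_measurable P) (mQ : kernel_measurable Q).
Hypothesis PQ : dual_pair nu1 nu2 P Q.

Lemma kernel_operator_dual (D : set (L2 k nu2)) (D' : set (L2 k nu1)) g Tg f Tf :
  kernel_operator nu1 nu2 P D (g, Tg) -> L2_kernel_dom nu1 P g ->
  kernel_operator nu2 nu1 Q D' (f, Tf) -> L2_kernel_dom nu2 Q f ->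
  inner f Tg = inner Tf g.
Proof.
move=> gTg gP fTf fQ; have QP := dual_pair_sym PQ.
(* [inner_kernel_operator] expects the image in the second slot, so the right side is conjugated;
   the sign change of its imaginary part is what makes the mixed terms match. *)
rewrite [RHS]inner_conj (inner_kernel_operator mP mQ PQ _ gTg gP).
rewrite (inner_kernel_operator mQ mP QP _ fTf fQ).
have /square_integrableP[rg mg] := L2_repr_square g.
have /square_integrableP[rf mf] := L2_repr_square f.
have [[rgP mgP] [rfQ mfQ]] := (gP, fQ).
have E u v := @dual_kernel_form _ _ _ _ _ _ _ _ _ mP mQ PQ u v.
have Err := E _ _ rgP rg rfQ rf.
have Emm := E _ _ mgP mg mfQ mf.
have Erm := E _ _ rgP rg mfQ mf.
have Emr := E _ _ mgP mg rfQ rf.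
by rewrite conj_mk opprB; congr mk_scalar; [congr (_ + _)|congr (_ - _)].
Qed.

(** The kernel acts on real and imaginary parts separately and squared norms add over them, so the
    real inequality [integral_sqr_kernel_le] is applied once to each part. *)
Lemma L2norm_kernel_operator_le (D : set (L2 k nu2)) g h :
  (forall x, P x setT = 1%E) -> (forall y, Q y setT = 1%E) ->
  kernel_operator nu1 nu2 P D (g, h) -> L2norm h <= L2norm g.
Proof.
move=> P1 Q1 /(kernel_operatorP mP mQ PQ)[_ gh].
have /square_integrableP[rg mg] := L2_repr_square g.
have /square_integrableP[rh mh] := L2_repr_square h.
have le_sqr (u : X2 -> R) (v : X1 -> R) : u \in Lfun nu2 2%:E ->
    v \in Lfun nu1 2%:E -> (\forall x \ae nu1, v x = \int[P x]_y u y) ->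
    \int[nu1]_x (v x ^+ 2) <= \int[nu2]_y (u y ^+ 2).
  move=> u2 v2 vu; have mu := Lfun2_measurable u2.
  rewrite (@ae_eq_Rintegral _ _ _ _ _ (fun x => (\int[P x]_y u y) ^+ 2)).
  - rewrite -lee_fin -[leRHS]Rintegral_integrable_fin; last exact: Lfun2_integrable_sqr.
    rewrite -Rintegral_integrable_fin; first exact: (integral_sqr_kernel_le mP mQ PQ).
    apply: Lfun2_integrable_sqr; apply: (kernel_dom_Lfun mP).
    exact: (kernel_dom_probability mP mQ PQ).
  - by apply: measurable_funX; exact: Lfun2_measurable v2.
  - by apply: measurable_funX; exact: measurable_fun_Rintegral_kernel.
  - by apply: filterS vu => x ->.
rewrite ler_wsqrtr// !re_innerE lerD//; apply: le_sqr => //.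
  by apply: filterS gh => x [_ ->]; rewrite re_integral.
by apply: filterS gh => x [_ ->]; rewrite im_integral.
Qed.

End dual_kernel_operators.

(** * Adherence, closability and density *)

Section L2_closure.
Context {R : realType} {k : scalar_kind} {d} {T : measurableType d}.
Variable mu : {measure set T -> \bar R}.
Local Notation K := (scalars R k).
Implicit Types (f g h : L2 k mu) (D : set (L2 k mu)).

Lemma L2normZD_le (a : K) f g f' g' :
  L2norm (a *: f + g - (a *: f' + g')) <=
  scalar_norm a * L2norm (f - f') + L2norm (g - g').
Proof.
rewrite opprD addrACA -scalerBr -L2normZ; exact: L2normD.
Qed.

(** A tolerance d on both arguments costs d times [scalar_norm a + 1]. The same tolerance serves
    both coordinates of a graph, which gives linearity of its closure. *)
Lemma L2norm_lin_lt (a : K) (e : R) f g f' g' : 0 < e ->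
  L2norm (f - f') < e / (scalar_norm a + 1) ->
  L2norm (g - g') < e / (scalar_norm a + 1) ->
  L2norm (a *: f + g - (a *: f' + g')) < e.
Proof.
move=> e0 ff' gg'; apply: le_lt_trans (L2normZD_le _ _ _ _ _) _.
have a0 : 0 <= scalar_norm a by exact: sqrtr_ge0.
have a1 : scalar_norm a + 1 != 0 by rewrite gt_eqF// ltr_wpDl.
rewrite -[ltRHS](divfK a1) mulrDr mulr1 mulrC ler_ltD//.
by rewrite ler_wpM2r// ltW.
Qed.

Definition L2_adherent D f := forall e : R, 0 < e -> exists2 g, D g & L2norm (f - g) < e.

Lemma L2_adherentZD D : (forall a f g, D f -> D g -> D (a *: f + g)) ->
  forall a f g, L2_adherent D f -> L2_adherent D g -> L2_adherent D (a *: f + g).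
Proof.
move=> DZD a f g Df Dg e e0.
have d0 : 0 < e / (scalar_norm a + 1) by rewrite divr_gt0// ltr_wpDl// sqrtr_ge0.
have [f' Df' ff'] := Df _ d0; have [g' Dg' gg'] := Dg _ d0.
by exists (a *: f' + g'); [exact: DZD|exact: L2norm_lin_lt].
Qed.

(** Subtracting from the first [h] an approximant [g] in [D] leaves the squared norm of [h]
    unchanged, by orthogonality, and Cauchy-Schwarz makes it small. *)
Lemma L2_dense_orthogonal_eq0 D h : L2_dense D ->
  (forall f, D f -> inner f h = 0) -> h = 0.
Proof.
move=> Ddense Dh; apply: inner_eq0.
set j := mk_scalar 0 1 : K.
(* The 1 accounts for the real part and [scalar_norm j] for the imaginary part, which is reached by
   multiplying by [j]. *)
apply: (@scalar_small_eq0 _ _ _ ((1 + scalar_norm j) * L2norm h)) => e e0.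
have [g Dg hg] := Ddense h e e0.
have -> : inner h h = inner (h - g) h by rewrite innerBl (Dh _ Dg) subr0.
have hge : L2norm (h - g) * L2norm h <= e * L2norm h.
  by rewrite ler_wpM2r// ?L2norm_ge0// ltW.
have j0 : 0 <= scalar_norm j by exact: sqrtr_ge0.
have he0 : 0 <= e * L2norm h by rewrite mulr_ge0 ?L2norm_ge0// ltW.
rewrite mulrAC -mulrA mulrDl mul1r; split.
  by rewrite (le_trans (re_inner_le _ _))// (le_trans hge)// lerDl mulr_ge0.
rewrite im_re normrN -innerZl (le_trans (re_inner_le _ _))// L2normZ -mulrA.
by rewrite (le_trans (ler_wpM2l j0 hge))// lerDr.
Qed.

End L2_closure.

Section closable.
Context {R : realType} {k : scalar_kind} {d1 d2 : measure_display}.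
Context {X1 : measurableType d1} {X2 : measurableType d2}.
Context {nu1 : {measure set X1 -> \bar R}} {nu2 : {measure set X2 -> \bar R}}.
Local Notation K := (scalars R k).
Implicit Types (G : set (L2 k nu1 * L2 k nu2)) (H : set (L2 k nu2 * L2 k nu1)).

(** Adjoints are closed: for a fixed [q] in [H], the defect [inner q.2 p.1 - inner q.1 p.2] is
    continuous in [p] and vanishes on [G]. Its modulus of continuity is governed by the two norms of
    [q], whose sum is [N]. *)
Lemma graph_closure_adjoint G H : G `<=` adjoint H -> graph_closure G `<=` adjoint H.
Proof.
move=> GH p pG q Hq; apply/eqP; rewrite -subr_eq0; apply/eqP.
set j := mk_scalar 0 1 : K.
have j0 : 0 <= scalar_norm j by exact: sqrtr_ge0.
pose N := L2norm q.2 + L2norm q.1.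
have N0 : 0 <= N by rewrite addr_ge0 ?L2norm_ge0.
apply: (@scalar_small_eq0 _ _ _ ((1 + scalar_norm j) * N)) => e e0.
have [p' [Gp' pp1 pp2]] := pG e e0.
have -> : inner q.2 p.1 - inner q.1 p.2 =
    inner q.2 (p.1 - p'.1) - inner q.1 (p.2 - p'.2).
  by rewrite !innerBr (GH _ Gp' _ Hq) opprB addrA addrNK.
have small : L2norm q.2 * L2norm (p.1 - p'.1) + L2norm q.1 * L2norm (p.2 - p'.2) <= N * e.
  by rewrite mulrDl lerD// ler_wpM2l ?L2norm_ge0// ltW.
have Ne0 : 0 <= N * e by rewrite mulr_ge0// ltW.
rewrite -mulrA mulrDl mul1r; split.
  rewrite reD reN (le_trans (ler_normB _ _))//.
  rewrite (le_trans (lerD (re_inner_le _ _) (re_inner_le _ _)))//.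
  by rewrite (le_trans small)// lerDl mulr_ge0.
rewrite im_re normrN mulrBr -!innerZl reD reN (le_trans (ler_normB _ _))//.
rewrite (le_trans (lerD (re_inner_le _ _) (re_inner_le _ _)))// !L2normZ -!mulrA -mulrDr.
by rewrite (le_trans (ler_wpM2l j0 small))// lerDr.
Qed.

(** If the closure contains [(f, h)] and [(f, h')], it contains [(0, h - h')]. This pair lies in the
    adjoint of [H], so [h - h'] is orthogonal to the dense domain of [H]. *)
Lemma closable_sub_adjoint G H : is_operator G -> densely_defined H ->
  G `<=` adjoint H -> closable G.
Proof.
move=> [G0 GZD _] Hdense GH.
have CZD a p q : graph_closure G p -> graph_closure G q -> graph_closure G (a *: p + q).
  move=> Gp Gq e e0.
  have d0 : 0 < e / (scalar_norm a + 1) by rewrite divr_gt0// ltr_wpDl// sqrtr_ge0.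
  have [p' [Gp' pp1 pp2]] := Gp _ d0; have [q' [Gq' qq1 qq2]] := Gq _ d0.
  exists (a *: p' + q'); split; first exact: GZD.
    exact: L2norm_lin_lt.
  exact: L2norm_lin_lt.
split=> //.
  by move=> e e0; exists 0; split=> //; rewrite subrr L2norm0.
move=> f h h' fh fh'; apply/eqP; rewrite -subr_eq0; apply/eqP.
apply: (L2_dense_orthogonal_eq0 Hdense) => q [q' Hq].
have C0 : graph_closure G (0, h - h').
  have := CZD (-1) _ _ fh' fh.
  rewrite (_ : _ *: _ + _ = (0, h - h'))//.
  by congr pair; rewrite /= scaleN1r ?addNr// addrC.
by have := graph_closure_adjoint GH C0 Hq; rewrite /= inner0r.
Qed.

End closable.

(** * Density of the span of indicators of sets of finite measure *)

Section finite_measure_span_theory.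
Context {R : realType} {k : scalar_kind} {d} {T : measurableType d}.
Variable mu : {measure set T -> \bar R}.
Local Notation K := (scalars R k).
Local Notation D := (finite_measure_span k mu).

Lemma finite_measure_span0 : D 0.
Proof.
exists 0%N, (fun=> 0), (fun=> set0); split; first by case.
by apply: filterS (@L2_repr0 _ k _ _ mu) => x ->; rewrite big_ord0.
Qed.

Lemma finite_measure_spanZD (a : K) (f g : L2 k mu) : D f -> D g -> D (a *: f + g).
Proof.
move=> [n [c [A [fA fE]]]] [m [c' [A' [fA' gE]]]].
exists (n + m)%N,
  (fun i => match fintype.split i with inl j => a * c j | inr j => c' j end),
  (fun i => match fintype.split i with inl j => A j | inr j => A' j end); split.
  by move=> i; case: (fintype.split i).
apply: filterS3 fE gE (L2_reprZD a f g) => x fx gx ->.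
rewrite fx gx big_split_ord mulr_sumr /=; congr (_ + _); apply: eq_bigr => i _.
  by rewrite (unsplitK (inl i)) mulrA.
by rewrite (unsplitK (inr i)).
Qed.

Lemma real_square_integrable (u : T -> R) : u \in Lfun mu 2%:E ->
  ((fun x => mk_scalar (u x) 0) : T -> K^o) \in square_integrable mu.
Proof.
move=> u2; apply/square_integrableP; split.
  by rewrite (_ : _ \o _ = u)//; apply/funext => x; exact: re_mk.
rewrite (_ : _ \o _ = fun x => 0 * u x); first exact: Lfun2Z.
by apply/funext => x; rewrite mul0r; exact: im_mk0.
Qed.

Definition L2_real (u : T -> R) (u2 : u \in Lfun mu 2%:E) : L2 k mu :=
  L2_class (L2Fun (real_square_integrable u2)).

Lemma L2_repr_real (u : T -> R) (u2 : u \in Lfun mu 2%:E) :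
  \forall x \ae mu, L2_repr (L2_real u2) x = mk_scalar (u x) 0.
Proof. exact: L2_repr_class. Qed.

Import HBNNSimple.

Lemma mk_scalar_indic (r : R) A (x : T) :
  mk_scalar (r * \1_A x) 0 = mk_scalar r 0 * \1_A x :> K.
Proof.
by rewrite !indicE; case: (x \in A); rewrite ?mulr1// !mulr0 mk_scalar0.
Qed.

Lemma nnsfun_in_span (h : {nnsfun T >-> R}) (h2 : (h : T -> R) \in Lfun mu 2%:E) :
  D (L2_real h2).
Proof.
(* The value 0 is discarded since its level set may have infinite measure; it contributes nothing to
   the sum. *)
pose s := [seq r <- fset_set (range h) | r != 0].
pose A r := h @^-1` [set r].
have hE x : h x = \sum_(r <- s) r * \1_(A r) x.
  rewrite fimfunE fsbig_finite//= big_filter big_mkcond [RHS]big_mkcond/=.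
  by apply: eq_bigr => r _; have [->|r0] := eqVneq r 0; rewrite ?mul0r.
exists (size s), (fun i => mk_scalar s`_i 0), (fun i => A s`_i); split.
  move=> i; have mA : measurable (A s`_i) by exact: measurable_sfunP.
  split=> //.
  have si0 : s`_i != 0.
    by have := mem_nth 0 (ltn_ord i); rewrite mem_filter => /andP[].
  (* Chebyshev: on the level set of a nonzero value r the function [h / r] equals 1, so the
     indicator is bounded by the integrable function [(h / r) ^+ 2]. *)
  have /Lfun2P[_] := Lfun2Z (s`_i)^-1 h2; apply: le_lt_trans.
  rewrite -[X in mu X]setIT -integral_indic//.
  apply: ge0_le_integral => //.
  - exact/measurable_EFinP/measurable_indic.
  - by apply/measurable_EFinP/measurable_funX/measurable_funM.
  - move=> x _; rewrite lee_fin indicE; case: (boolP (x \in A s`_i)) => [|_].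
      by rewrite inE => ->; rewrite mulVf// expr1n.
    by rewrite sqr_ge0.
apply: filterS (L2_repr_real h2) => x ->.
rewrite -(big_mkord xpredT (fun i => mk_scalar s`_i 0 * \1_(A s`_i) x)).
rewrite -(big_nth 0 xpredT (fun r => mk_scalar r 0 * \1_(A r) x)) hE.
rewrite (big_morph (fun r => mk_scalar r 0 : K) mk_scalarD mk_scalar0).
by apply: eq_bigr => r _; exact: mk_scalar_indic.
Qed.

(** Simple functions approach [u] from below, so the squared error is dominated by [u ^+ 2] and its
    integral tends to 0 by dominated convergence. *)
Lemma nonneg_adherent (u : T -> R) (u2 : u \in Lfun mu 2%:E) :
  (forall x, 0 <= u x) -> L2_adherent D (L2_real u2).
Proof.
move=> u0 e e0; have mu' := Lfun2_measurable u2.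
have mu_ : measurable_fun setT (EFin \o u) by exact/measurable_EFinP.
pose h := nnsfun_approx measurableT mu_.
have h0u n x : 0 <= h n x <= u x.
  by rewrite fun_ge0/= nnsfun_approxE -lee_fin; apply: le_approx => // y _; rewrite /= lee_fin.
have h2 n : (h n : T -> R) \in Lfun mu 2%:E.
  apply: Lfun2_le_ae u2 => //; apply: aeW => x.
  by have /andP[hx0 hxu] := h0u n x; rewrite !ger0_norm// (le_trans hx0).
have hu x : (h n x)%:E @[n --> \oo] --> (u x)%:E.
  by apply: (cvg_nnsfun_approx measurableT mu_) => // y _; rewrite /= lee_fin.
have mhu n : measurable_fun setT (fun x => ((u x - h n x) ^+ 2)%:E).
  by apply/measurable_EFinP/measurable_funX/measurable_funB.
have : (\int[mu]_x ((u x - h n x) ^+ 2)%:E @[n --> \oo] --> \int[mu]_x (cst 0 x))%E.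
  apply: (@dominated_cvg _ _ _ mu setT measurableT _ _ (fun x => (u x ^+ 2)%:E)) => //.
  - move=> x _; apply: cvg_EFin; first exact: nearW.
    have c : (u x - h n x) @[n --> \oo] --> (0 : R).
      by rewrite -(subrr (u x)); apply: cvgB; [exact: cvg_cst|exact: fine_cvg (hu x)].
    by rewrite -[X in _ --> X](mulr0 0); exact: (cvgM c c).
  - exact: Lfun2_integrable_sqr.
  - move=> n x _; have /andP[hx0 hxu] := h0u n x.
    by rewrite /= lee_fin ger0_norm ?sqr_ge0// lerXn2r ?nnegrE ?subr_ge0// gerBl.
rewrite integral_cst//= mul0e => cv.
have [n hn] : exists n, (\int[mu]_x ((u x - h n x) ^+ 2)%:E < (e ^+ 2)%:E)%E.
  (* The convergence yields eventual finiteness and an eventual bound on [fine] separately; an index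
     beyond both thresholds is taken. *)
  have /fine_cvgP[[N1 _ fin1] /cvgr_lt-/(_ (e ^+ 2))] := cv.
  rewrite exprn_gt0// => /(_ isT)[N2 _ lt2]; exists (maxn N1 N2).
  by rewrite -[ltLHS]fineK ?fin1//= ?leq_maxl// lte_fin lt2//= leq_maxr.
exists (L2_real (h2 n)); first exact: nnsfun_in_span.
rewrite -(@ltr_pXn2r _ 2)// ?nnegrE ?L2norm_ge0 ?ltW// sqr_L2norm.
have uh2 := Lfun2D u2 (Lfun2N (h2 n)).
have -> : L2_real u2 - L2_real (h2 n) = L2_real uh2.
  rewrite addrC -scaleN1r; apply/L2_eqP.
  apply: filterS3 (L2_reprZD (-1) (L2_real (h2 n)) (L2_real u2))
    (filterI (L2_repr_real u2) (L2_repr_real (h2 n))) (L2_repr_real uh2) => x -> [-> ->] ->.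
  rewrite mulN1r addrC mk_scalarD; congr (_ + _).
  by apply: scalar_ext; rewrite ?(reN, imN, re_mk, im_mk0) ?oppr0.
rewrite re_inner_class -lte_fin; apply: le_lt_trans hn.
rewrite -Rintegral_integrable_fin.
  rewrite le_eqVlt; apply/orP; left; apply/eqP; apply: eq_integral => x _.
  by rewrite /= re_mk im_mk0 expr0n addr0.
have := Lfun2_integrable_sqr uh2; congr (_.-integrable _ _).
by apply/funext => x; rewrite /= re_mk im_mk0 [0 ^+ 2]expr0n addr0.
Qed.

Lemma real_adherent (u : T -> R) (u2 : u \in Lfun mu 2%:E) :
  L2_adherent D (L2_real u2).
Proof.
pose up x : R := Num.max (u x) 0; pose un x : R := Num.max (- u x) 0.
have mu' := Lfun2_measurable u2.
have max0 (x : R) : 0 <= Num.max x 0 by rewrite le_max lexx orbT.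
have max_le (x : R) : `|Num.max x 0| <= `|x|.
  by case: (leP x 0) => _; rewrite ?normr0 ?normr_ge0.
have up2 : up \in Lfun mu 2%:E.
  apply: Lfun2_le_ae u2; first exact: measurable_maxr.
  by apply: aeW => x; exact: max_le.
have un2 : un \in Lfun mu 2%:E.
  apply: Lfun2_le_ae u2; first by apply: measurable_maxr => //; exact: measurableT_comp.
  by apply: aeW => x; rewrite -[leRHS]normrN; exact: max_le.
have -> : L2_real u2 = -1 *: L2_real un2 + L2_real up2.
  apply/L2_eqP; apply: filterS3 (L2_reprZD (-1) (L2_real un2) (L2_real up2))
    (filterI (L2_repr_real un2) (L2_repr_real up2)) (L2_repr_real u2) => x -> [-> ->] ->.
  rewrite mulN1r addrC [in LHS](pos_neg_parts u) mk_scalarD; congr (_ + _).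
  by apply: scalar_ext; rewrite ?(reN, imN, re_mk, im_mk0) ?oppr0.
apply: L2_adherentZD; first exact: finite_measure_spanZD.
  exact: nonneg_adherent (fun=> max0 _).
exact: nonneg_adherent (fun=> max0 _).
Qed.

Lemma finite_measure_span_dense : L2_dense D.
Proof.
move=> f; have /square_integrableP[rf mf] := L2_repr_square f.
(* Over the reals the coefficient [mk_scalar 0 1] is 0, so the same decomposition covers both
   fields. *)
have -> : f = mk_scalar 0 1 *: L2_real mf + L2_real rf.
  apply/L2_eqP; apply: filterS3 (L2_reprZD (mk_scalar 0 1) (L2_real mf) (L2_real rf))
    (L2_repr_real mf) (L2_repr_real rf) => x -> -> ->.
  by rewrite addrC [LHS]scalarE.
apply: L2_adherentZD; [exact: finite_measure_spanZD|exact: real_adherent..].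
Qed.

End finite_measure_span_theory.

(** * The span lies in the domain of a finite kernel *)

Section kernel_dom_span.
Context {R : realType} {k : scalar_kind} {d1 d2 : measure_display}.
Context {X1 : measurableType d1} {X2 : measurableType d2}.
Variables (nu1 : {measure set X1 -> \bar R}) (nu2 : {measure set X2 -> \bar R}).
Variables (P : X1 -> {measure set X2 -> \bar R}) (Q : X2 -> {measure set X1 -> \bar R}).
Hypotheses (mP : kernel_measurable P) (mQ : kernel_measurable Q).
Hypothesis PQ : dual_pair nu1 nu2 P Q.
Hypothesis finP : forall x, (P x setT < +oo)%E.
Hypothesis P2 : forall B, measurable B -> (nu2 B < +oo)%E ->
  (fun x => fine (P x B)) \in Lfun nu1 2%:E.

Lemma kernel_dom_indic B : measurable B -> (nu2 B < +oo)%E -> kernel_dom nu1 P \1_B.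
Proof.
move=> mB nuB; split; first exact: measurable_indic.
  apply: filterE => x; apply/integrableP; split.
    exact/measurable_EFinP/measurable_indic.
  rewrite (eq_integral (EFin \o \1_B)) => [|y _]; last by rewrite /= ger0_norm.
  rewrite integral_indic// setIT; apply: le_lt_trans (finP x).
  by apply: le_measure; rewrite ?inE.
rewrite (_ : (fun _ => _) = fun x => fine (P x B)); first exact: P2.
apply/funext => x; rewrite /Rintegral (eq_integral (EFin \o \1_B)) => [|y _].
  by rewrite integral_indic// setIT.
by rewrite /= ger0_norm.
Qed.

Lemma kernel_dom_sum (n : nat) (c : 'I_n -> R) (B : 'I_n -> set X2) :
  (forall i, measurable (B i) /\ (nu2 (B i) < +oo)%E) ->
  kernel_dom nu1 P (fun y => \sum_(i < n) c i * \1_(B i) y).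
Proof.
move=> fB.
(* Arbitrary lists of indices replace the enumeration of ['I_n], so that the induction goes through
   with [c] and [B] fixed. *)
have sumE s : kernel_dom nu1 P (fun y => \sum_(i <- s) c i * \1_(B i) y).
  elim: s => [|i s ih].
    rewrite (_ : (fun _ => _) = \1_(set0 : set X2)).
      by apply: kernel_dom_indic => //; rewrite measure0.
    by apply/funext => y; rewrite big_nil indic0.
  under eq_fun do rewrite big_cons.
  by apply: kernel_domZD => //; apply: kernel_dom_indic; case: (fB i).
exact: sumE.
Qed.

Lemma re_mul_indic (c : scalars R k) (B : set X2) y : re (c * \1_B y) = re c * \1_B y.
Proof. by rewrite !indicE; case: (y \in B); rewrite ?mulr1// !mulr0 re0. Qed.

Lemma im_mul_indic (c : scalars R k) (B : set X2) y : im (c * \1_B y) = im c * \1_B y.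
Proof. by rewrite !indicE; case: (y \in B); rewrite ?mulr1// !mulr0 im0. Qed.

(** The representative of an element of the span equals a simple function only almost everywhere;
    [kernel_dom_le] absorbs the difference. *)
Lemma span_kernel_dom : finite_measure_span k nu2 `<=` L2_kernel_dom nu1 P.
Proof.
move=> f [n [c [B [fB fE]]]].
have [mrf mif] := square_integrable_measurable (L2_repr_square f).
split.
  apply: (kernel_dom_le mP mQ PQ mrf _ (kernel_dom_sum (fun i => re (c i)) fB)).
  apply: filterS fE => y fy; rewrite /= fy (big_morph _ (@reD R k) re0).
  by under eq_bigr do rewrite re_mul_indic.
apply: (kernel_dom_le mP mQ PQ mif _ (kernel_dom_sum (fun i => im (c i)) fB)).
apply: filterS fE => y fy; rewrite /= fy (big_morph _ (@imD R k) im0).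
by under eq_bigr do rewrite im_mul_indic.
Qed.

End kernel_dom_span.

(** * From graphs to linear maps and their adjoints *)

Lemma linear_of_operator {R : realType} {k : scalar_kind} {d1 d2 : measure_display}
    {X1 : measurableType d1} {X2 : measurableType d2}
    {nu1 : {measure set X1 -> \bar R}} {nu2 : {measure set X2 -> \bar R}}
    (G : set (L2 k nu1 * L2 k nu2)) :
  is_operator G -> domain G = setT ->
  exists T : {linear L2 k nu1 -> L2 k nu2}, operator_graph T = G.
Proof.
move=> [G0 GZD Gfun] Gdom.
have Gex f : exists h, G (f, h) by have : domain G f by rewrite Gdom.
(* Values are picked by choice; since the graph is single-valued and closed under linear
   combinations, the picked map is linear. *)
pose T f := projT1 (cid (Gex f)).
have GT f : G (f, T f) by exact: projT2 (cid (Gex f)).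
have Tlin : linear T.
  move=> a f g; apply: (Gfun (a *: f + g)); first exact: GT.
  exact: (GZD a _ _ (GT f) (GT g)).
pose TL := HB.pack_for {linear L2 k nu1 -> L2 k nu2} T (GRing.isLinear.Build _ _ _ _ T Tlin).
exists TL; apply/seteqP; split=> [[f h] fh|[f h] Gfh].
  by have -> : h = T f by exact: fh.
by apply: (Gfun f) => //; exact: GT.
Qed.

Section probability_operator.
Context {R : realType} {k : scalar_kind} {d1 d2 : measure_display}.
Context {X1 : measurableType d1} {X2 : measurableType d2}.
Variables (nu1 : {measure set X1 -> \bar R}) (nu2 : {measure set X2 -> \bar R}).
Variables (P : X1 -> {measure set X2 -> \bar R}) (Q : X2 -> {measure set X1 -> \bar R}).
Hypotheses (mP : kernel_measurable P) (mQ : kernel_measurable Q).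
Hypothesis PQ : dual_pair nu1 nu2 P Q.

Lemma L2_kernel_dom_probability (f : L2 k nu2) :
  (forall x, P x setT = 1%E) -> (forall y, Q y setT = 1%E) -> L2_kernel_dom nu1 P f.
Proof.
move=> P1 Q1; have /square_integrableP[rf mf] := L2_repr_square f.
by split; exact: (kernel_dom_probability mP mQ PQ).
Qed.

Lemma probability_kernel_operator :
  (forall x, P x setT = 1%E) -> (forall y, Q y setT = 1%E) ->
  exists TP : {linear L2 k nu2 -> L2 k nu1},
    operator_graph TP = kernel_operator nu1 nu2 P [set: L2 k nu2] /\
    forall g, L2norm (TP g) <= L2norm g.
Proof.
move=> P1 Q1.
have [|TP TPE] := linear_of_operator
    (kernel_operator_is_operator mP mQ PQ (D := [set: L2 k nu2]) I (fun _ _ _ _ _ => I)).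
  by apply: (domain_kernel_operator mP mQ PQ) => f _; exact: L2_kernel_dom_probability.
exists TP; split=> // g; apply: (L2norm_kernel_operator_le (D := setT) mP mQ PQ P1 Q1).
by rewrite -TPE.
Qed.

Lemma adjoint_operator_graph (TP : {linear L2 k nu2 -> L2 k nu1})
    (TQ : {linear L2 k nu1 -> L2 k nu2}) :
  (forall f g, inner f (TP g) = inner (TQ f) g) ->
  adjoint (operator_graph TP) = operator_graph TQ.
Proof.
move=> TPQ; apply/seteqP; split=> [[h h'] hh'|[h h'] hE [g Tg] gE]; last first.
  have -> : h' = TQ h by exact: hE.
  have -> : Tg = TP g by exact: gE.
  by rewrite /= inner_conj TPQ -inner_conj.
apply/eqP; rewrite -subr_eq0; apply/eqP; apply: inner_eq0 => /=.
set w := h' - TQ h; have /= := hh' (w, TP w) erefl.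
by rewrite innerBr inner_conj TPQ -inner_conj => ->; rewrite subrr.
Qed.

Lemma finite_kernel_operator :
  (forall x, (P x setT < +oo)%E) ->
  (forall B, measurable B -> (nu2 B < +oo)%E ->
    (fun x => fine (P x B)) \in Lfun nu1 2%:E) ->
  let TP := kernel_operator nu1 nu2 P (finite_measure_span k nu2) in
  [/\ is_operator TP, domain TP = finite_measure_span k nu2 & densely_defined TP].
Proof.
move=> finP P2 TP.
have TPdom : domain TP = finite_measure_span k nu2.
  by apply: (domain_kernel_operator mP mQ PQ); exact: (span_kernel_dom mP mQ PQ).
split=> //.
  apply: (kernel_operator_is_operator mP mQ PQ); first exact: finite_measure_span0.
  exact: finite_measure_spanZD.
by rewrite /densely_defined TPdom; exact: finite_measure_span_dense.
Qed.

End probability_operator.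

Lemma kernel_operator_sub_adjoint {R : realType} {k : scalar_kind}
    {d1 d2 : measure_display} {X1 : measurableType d1} {X2 : measurableType d2}
    (nu1 : {measure set X1 -> \bar R}) (nu2 : {measure set X2 -> \bar R})
    (P : X1 -> {measure set X2 -> \bar R}) (Q : X2 -> {measure set X1 -> \bar R})
    (D : set (L2 k nu2)) (D' : set (L2 k nu1)) :
  kernel_measurable P -> kernel_measurable Q -> dual_pair nu1 nu2 P Q ->
  D `<=` L2_kernel_dom nu1 P -> D' `<=` L2_kernel_dom nu2 Q ->
  kernel_operator nu1 nu2 P D `<=` adjoint (kernel_operator nu2 nu1 Q D').
Proof.
move=> mP mQ PQ DP DQ [g Tg] gTg [f Tf] fTf /=; apply/esym.
apply: (kernel_operator_dual mP mQ PQ gTg _ fTf).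
  by apply: DP; case: gTg.
by apply: DQ; case: fTf.
Qed.

Theorem theorem6p6 (R : realType) (k : scalar_kind) (d1 d2 : measure_display)
    (X1 : measurableType d1) (X2 : measurableType d2)
    (sX1 : standard_borel R X1) (sX2 : standard_borel R X2)
    (nu1 : {sigma_finite_measure set X1 -> \bar R})
    (nu2 : {sigma_finite_measure set X2 -> \bar R}) :
  [/\ forall (P : R.-pker X1 ~> X2) (Q : R.-pker X2 ~> X1),
        dual_pair nu1 nu2 P Q ->
        (exists TP : {linear L2 k nu2 -> L2 k nu1},
          operator_graph TP = kernel_operator nu1 nu2 P [set: L2 k nu2] /\
          forall g, L2norm (TP g) <= L2norm g) /\
        (exists TQ : {linear L2 k nu1 -> L2 k nu2},
          operator_graph TQ = kernel_operator nu2 nu1 Q [set: L2 k nu1] /\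
          forall f, L2norm (TQ f) <= L2norm f),
      forall (P : R.-pker X1 ~> X2) (Q : R.-pker X2 ~> X1),
        dual_pair nu1 nu2 P Q ->
        forall (TP : {linear L2 k nu2 -> L2 k nu1})
               (TQ : {linear L2 k nu1 -> L2 k nu2}),
        operator_graph TP = kernel_operator nu1 nu2 P [set: L2 k nu2] ->
        operator_graph TQ = kernel_operator nu2 nu1 Q [set: L2 k nu1] ->
        [/\ forall f g, inner f (TP g) = inner (TQ f) g,
            adjoint (operator_graph TP) = operator_graph TQ
          & adjoint (operator_graph TQ) = operator_graph TP]
    & forall (P : R.-ker X1 ~> X2) (Q : R.-ker X2 ~> X1),
        positive_finite_kernel P -> positive_finite_kernel Q ->
        dual_pair nu1 nu2 P Q ->
        (forall B, measurable B -> (nu2 B < +oo)%E ->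
          (fun x => fine (P x B)) \in Lfun nu1 2%:E) ->
        (forall A, measurable A -> (nu1 A < +oo)%E ->
          (fun y => fine (Q y A)) \in Lfun nu2 2%:E) ->
        let TP := kernel_operator nu1 nu2 P (finite_measure_span k nu2) in
        let TQ := kernel_operator nu2 nu1 Q (finite_measure_span k nu1) in
        [/\ [/\ is_operator TP, domain TP = finite_measure_span k nu2
              & densely_defined TP],
            [/\ is_operator TQ, domain TQ = finite_measure_span k nu1
              & densely_defined TQ],
            TP `<=` adjoint TQ, TQ `<=` adjoint TP
          & closable TP /\ closable TQ]].
Proof.
have meas d d' (X : measurableType d) (Y : measurableType d') (S : R.-ker X ~> Y) :
    kernel_measurable S by move=> U; exact: measurable_kernel.
split.
- move=> P Q PQ; have [mP mQ] := (meas _ _ _ _ P, meas _ _ _ _ Q); split.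
    by apply: (probability_kernel_operator mP mQ PQ) => x; exact: prob_kernel.
  by apply: (probability_kernel_operator mQ mP (dual_pair_sym PQ)) => x; exact: prob_kernel.
- move=> P Q PQ TP TQ TPE TQE; have QP := dual_pair_sym PQ.
  have [mP mQ] := (meas _ _ _ _ P, meas _ _ _ _ Q).
  have inner_TPQ f g : inner f (TP g) = inner (TQ f) g.
    apply: (kernel_operator_dual mP mQ PQ (D := setT) (D' := setT)).
    - by rewrite -TPE.
    - by apply: (L2_kernel_dom_probability mP mQ PQ) => x; exact: prob_kernel.
    - by rewrite -TQE.
    - by apply: (L2_kernel_dom_probability mQ mP QP) => x; exact: prob_kernel.
  split=> //; first exact: adjoint_operator_graph.
  by apply: adjoint_operator_graph => g f; rewrite inner_conj -inner_TPQ -inner_conj.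
- move=> P Q finP finQ PQ P2 Q2 TP TQ; have QP := dual_pair_sym PQ.
  have [mP mQ] := (meas _ _ _ _ P, meas _ _ _ _ Q).
  have {}finP x : (P x setT < +oo)%E by case/andP: (finP x).
  have {}finQ y : (Q y setT < +oo)%E by case/andP: (finQ y).
  have [opP domP denseP] := finite_kernel_operator (k := k) mP mQ PQ finP P2.
  have [opQ domQ denseQ] := finite_kernel_operator (k := k) mQ mP QP finQ Q2.
  have DP := @span_kernel_dom _ k _ _ _ _ _ _ _ _ mP mQ PQ finP P2.
  have DQ := @span_kernel_dom _ k _ _ _ _ _ _ _ _ mQ mP QP finQ Q2.
  have PadjQ : TP `<=` adjoint TQ by exact: kernel_operator_sub_adjoint.
  have QadjP : TQ `<=` adjoint TP by exact: kernel_operator_sub_adjoint.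
  by split=> //; split; [exact: closable_sub_adjoint PadjQ|exact: closable_sub_adjoint QadjP].
Qed.
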